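(* Let $\mathcal{R}$ be the set of all $\mathbb{F}$-functorials. Then: (a) $(\mathcal{R},\vee,\wedge)$ is a complete distributive lattice, where for a family $\{\gamma_i\mid i\in I\}$ of $\mathbb{F}$-functorials $(\bigwedge_{i\in I}\gamma_i)(G)=\bigcap_{i\in I}\gamma_i(G)$ and $(\bigvee_{i\in I}\gamma_i)(G)=\langle\gamma_i(G)\mid i\in I\rangle$; the functorials $\mathrm{F}^*$ and $\tilde{\mathrm{F}}$ are its smallest and largest elements respectively. (b) $(\mathcal{R},\circ)$ is a semigroup, $\mathrm{F}^*$ is its zero element, and $\tilde{\mathrm{F}}^\infty$ is its largest idempotent element. (c) If $\gamma$ is an $\mathbb{F}$-functorial and $\varphi$ is a Frattini functorial, then $\varphi\star\gamma$ is an $\mathbb{F}$-functorial, and $\varphi\star\tilde{\mathrm{F}}=\tilde{\mathrm{F}}$. (d) The cardinality of $\mathcal{R}$ is continuum.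
   Context: All groups are finite. A functorial is a function $\theta$ assigning to each group $G$ a characteristic subgroup $\theta(G)$ such that $f(\theta(G))=\theta(f(G))$ for every isomorphism $f:G\to G^*$. Consider the conditions, for every group $G$: (F1) $f(\gamma(G))\subseteq\gamma(f(G))$ for every epimorphism $f:G\to G^*$; (F2) $\gamma(N)\subseteq\gamma(G)$ for every $N\trianglelefteq G$; (F3) $C_G(\gamma(G))\subseteq\gamma(G)$; (F4) $\gamma(G)/\Phi(G)\subseteq\mathrm{Soc}(G/\Phi(G))$. An $\mathbb{F}$-functorial is a functorial satisfying (F1)–(F4) for all groups. A Frattini functorial is a functorial $\varphi$ satisfying (F1), (F2) and $\varphi(G)\subseteq\Phi(G)$ for all $G$. $\mathrm{F}^*(G)$ is the generalized Fitting subgroup (largest normal quasinilpotent subgroup); $\tilde{\mathrm{F}}(G)$ is defined by $\Phi(G)\subseteq\tilde{\mathrm{F}}(G)$ and $\tilde{\mathrm{F}}(G)/\Phi(G)=\mathrm{Soc}(G/\Phi(G))$. Functorials are ordered by $\gamma\le\delta$ iff $\gamma(G)\subseteq\delta(G)$ for all $G$. Lower product: $(\gamma_1\circ\gamma_2)(G)=\gamma_2(\gamma_1(G))$. Upper product: $(\gamma_1\star\gamma_2)(G)$ is the subgroup containing $\gamma_1(G)$ with $(\gamma_1\star\gamma_2)(G)/\gamma_1(G)=\gamma_2(G/\gamma_1(G))$. A functorial $\gamma$ is idempotent if $\gamma(\gamma(G))=\gamma(G)$ for all $G$. $\gamma^{(1)}=\gamma$, $\gamma^{(i+1)}(G)=\gamma(\gamma^{(i)}(G))$,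 $\gamma^\infty(G)=\bigcap_{i\in\mathbb{N}}\gamma^{(i)}(G)$. *)

(* Defs.v *)
From HB Require Import structures.
From mathcomp Require Import all_boot all_fingroup all_solvable.
From Stdlib Require Import ClassicalEpsilon.
Unset Printing Implicit Defensive.
Import GroupScope.
Local Open Scope group_scope.

(* Classical boolean reflection of a proposition (used for intersections /
   unions over arbitrary, possibly infinite, index types). *)
Definition pb (P : Prop) : bool :=
  if excluded_middle_informative P then true else false.

Definition fmap := forall gT : finGroupType, {group gT} -> {group gT}.

Definition functorial (th : fmap) : Prop :=
  (forall (gT : finGroupType) (G : {group gT}), th gT G \char G) /\
  (forall (gT rT : finGroupType) (G : {group gT}) (f : {morphism G >-> rT}),
      'injm f -> f @* th gT G = th rT (f @* G)%G :> {set rT}).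

Definition Soc (gT : finGroupType) (G : {group gT}) : {group gT} :=
  << \bigcup_(M : {group gT} | (M \subset G) && minnormal M G) M >>%G.

Definition F1 (g : fmap) : Prop :=
  forall (gT rT : finGroupType) (G : {group gT}) (f : {morphism G >-> rT}),
    f @* g gT G \subset g rT (f @* G)%G.
Definition F2 (g : fmap) : Prop :=
  forall (gT : finGroupType) (G N : {group gT}), N <| G -> g gT N \subset g gT G.
Definition F3 (g : fmap) : Prop :=
  forall (gT : finGroupType) (G : {group gT}), 'C_G(g gT G) \subset g gT G.
Definition F4 (g : fmap) : Prop :=
  forall (gT : finGroupType) (G : {group gT}),
    g gT G / 'Phi(G) \subset Soc _ (G / 'Phi(G))%G.

Definition Ffunctorial (g : fmap) : Prop :=
  [/\ functorial g, F1 g, F2 g, F3 g & F4 g].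

Definition Frattini_functorial (p : fmap) : Prop :=
  [/\ functorial p, F1 p, F2 p &
      forall (gT : finGroupType) (G : {group gT}), p gT G \subset 'Phi(G)].

(* Quasinilpotent (Huppert-Blackburn X.13): for every chief factor H/K of G,
   G = H C_G(H/K), written in G/K. *)
Definition chief_factor (gT : finGroupType) (G H K : {group gT}) : bool :=
  (H <| G) && maxnormal K H G.

Definition quasinilpotent (gT : finGroupType) (G : {group gT}) : bool :=
  [forall H : {group gT}, forall K : {group gT},
     chief_factor _ G H K ==> (G / K \subset (H / K) * 'C_(G / K)(H / K))].

(* Generalized Fitting subgroup: (the product of) the normal quasinilpotent
   subgroups, i.e. the largest normal quasinilpotent subgroup. *)
Definition Fstar : fmap := fun gT G =>
  << \bigcup_(H : {group gT} | (H <| G) && quasinilpotent _ H) H >>%G.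

Definition Ftilde : fmap := fun gT G =>
  (coset 'Phi(G) @*^-1 Soc _ (G / 'Phi(G))%G)%G.

Definition fle (g d : fmap) : Prop :=
  forall (gT : finGroupType) (G : {group gT}), g gT G \subset d gT G.
Definition feq (g d : fmap) : Prop :=
  forall (gT : finGroupType) (G : {group gT}), g gT G :=: d gT G.

Definition fmeet (g d : fmap) : fmap := fun gT G => (g gT G :&: d gT G)%G.
Definition fjoin (g d : fmap) : fmap := fun gT G => (g gT G <*> d gT G)%G.

Definition fcomp (g1 g2 : fmap) : fmap := fun gT G => g2 gT (g1 gT G).

Definition fstar (g1 g2 : fmap) : fmap := fun gT G =>
  (coset (g1 gT G) @*^-1 g2 _ (G / g1 gT G)%G)%G.

Definition fidempotent (g : fmap) : Prop := feq (fcomp g g) g.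

(* fpow n g = g^(n+1). *)
Fixpoint fpow (n : nat) (g : fmap) : fmap :=
  match n with
  | 0 => g
  | n'.+1 => fun gT G => g gT (fpow n' g gT G)
  end.

(* g^oo(G) = intersection of all g^(i)(G) (a subgroup; << >> only provides the
   group structure of this intersection of subgroups). *)
Definition finf (g : fmap) : fmap := fun gT G =>
  << [set x | pb (forall n : nat, x \in fpow n g gT G)] >>%G.

(* Main.v *)
(** Every F-functorial lies between F* and F~.  Indeed F3 applied to cyclic
    subgroups, together with F2, forces gamma(N) = N for N nilpotent; if G is
    quasinilpotent and N <| G is minimal with R = gamma(N) <> N, then R contains
    every smaller normal subgroup of G inside N, hence N centralises all chief
    factors of G below R, and R is hypercentral in N; so N is nilpotent, or N is
    perfect, R is central by Gruen's lemma and F3 gives N = C_N(R) <= R.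
    Conversely F1, F2 and F* <= gamma <= F~ imply F3 (by C_G(F*(G)) <= F*(G)) and
    F4.  Normal subgroups M between F*(G) and F~(G) satisfy M = M' F*(G), because
    minimal normal subgroups of G/Phi(G) are abelian or perfect; distributivity
    follows since A :&: BC = [A :&: BC, A :&: BC] F* is contained in [A, BC] F*.

    For the cardinality, a set s of natural numbers gives the F-functorial
    generated by F* and the subnormal subgroups M with M/Phi(M) simple of order
    in s.  These are separated by Frattini extensions K of Alt_p (p >= 5 prime)
    which are not quasinilpotent.  Let Alt_p act on the flows with values in F_p
    on the complete digraph with vertex set F_p.  The pairs (m, s) such that the
    boundary of m is s^-1(0) - 0 form a group, in which a pair lying over the
    translation x |-> x + 1 never has order p.  A minimal subgroup K mapping onto
    Alt_p has Phi(K) as kernel, and Phi(K) is not central because x |-> x + 1 is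
    conjugate to its fourth power. *)

Require Import Defs.
From Stdlib Require FunctionalExtensionality ClassicalEpsilon.
From HB Require Import structures.
From mathcomp Require Import all_boot all_fingroup all_solvable.
From mathcomp Require Import ssralg zmodp.
Import GroupScope.
Local Open Scope group_scope.
Set Implicit Arguments.
Unset Strict Implicit.
Unset Printing Implicit Defensive.
(* Some names of Defs, such as F1, are shadowed by mathcomp. *)
Import Defs.

(** * Socles *)

Section Socle.
Variable gT : finGroupType.
Implicit Types G H K L M N T U Z : {group gT}.

(** [T \subset socle G T] expresses that [T] is completely reducible under [G]; [socle G G] is the
    socle of [G]. *)
Definition socle G T : {group gT} :=
  << \bigcup_(M : {group gT} | (M \subset T) && minnormal M G) M >>%G.

Lemma minnormal_norm M G : minnormal M G -> G \subset 'N(M).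
Proof. by case/mingroupp/andP. Qed.

Lemma minnormal_neq1 M G : minnormal M G -> M :!=: 1.
Proof. by case/mingroupp/andP. Qed.

Lemma minnormal_socle G T M :
  M \subset T -> minnormal M G -> M \subset socle G T.
Proof. by move=> sMT minM; rewrite sub_gen // (bigcup_sup M) ?sMT. Qed.

Lemma socle_subP G T K :
  (forall M, M \subset T -> minnormal M G -> M \subset K) ->
  socle G T \subset K.
Proof.
by move=> sMK; rewrite gen_subG; apply/bigcupsP=> M /andP[]; apply: sMK.
Qed.

Lemma socle_sub G T : socle G T \subset T.
Proof. exact: socle_subP. Qed.

Lemma socleS G T U : T \subset U -> socle G T \subset socle G U.
Proof.
move=> sTU; apply: socle_subP => M sMT.
by apply: minnormal_socle; apply: subset_trans sTU.
Qed.

Lemma socle_norm G T : G \subset 'N(socle G T).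
Proof.
by rewrite norms_gen ?norms_bigcup //; apply/bigcapsP=> M /andP[_ /minnormal_norm].
Qed.

Lemma Soc_normal G : Soc gT G <| G.
Proof. by rewrite /normal (socle_norm G G) (socle_sub G G). Qed.

Lemma Soc_socle G : Soc gT G \subset socle G (Soc gT G).
Proof.
by apply: socle_subP => M sMG minM; apply: minnormal_socle => //; apply: minnormal_socle.
Qed.

Lemma minnormal_subVTI G M N :
  minnormal M G -> G \subset 'N(N) -> M \subset N \/ M :&: N = 1.
Proof.
case/mingroupP=> /andP[ntM nMG] minM nNG.
have [->|ntMN] := eqVneq (M :&: N) 1; [by right | left].
by apply/setIidPl; apply: minM; rewrite ?ntMN ?normsI ?subsetIl.
Qed.

(** Take [K] maximal among the normal subgroups of [G] in [T] that meet [N] trivially; a minimal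
    normal subgroup outside [N * K] could be added to [K]. *)
Lemma socle_compl G T N :
    T \subset G -> T \subset socle G T -> N <| G -> N \subset T ->
  exists K, [/\ K <| G, K \subset T, N :&: K = 1 & T \subset N * K].
Proof.
move=> sTG socT /andP[sNG nNG] sNT.
pose P K := [&& K <| G, K \subset T & N :&: K == 1].
have [|K /maxgroupP[/and3P[nsKG sKT /eqP tiNK] maxK] _] := @maxgroup_exists _ P 1.
  by rewrite /P normal1 sub1G setIg1 eqxx.
have [sKG nKG] := andP nsKG; exists K; split=> //.
rewrite -(norm_joinEr (subset_trans sKG nNG)).
apply: subset_trans socT _; apply: socle_subP => M sMT minM.
have nMG := minnormal_norm minM.
have [//|tiM] := minnormal_subVTI minM (normsY nNG nKG).
have sMK: M \subset K; last by rewrite (subset_trans sMK) ?joing_subr.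
rewrite -(maxK (K <*> M)%G) ?joing_subl ?joing_subr //=.
apply/and3P; split; first by rewrite /normal normsY // join_subG sKG (subset_trans sMT).
  by rewrite join_subG sKT.
(* If [x = k * m] lies in [N], then [m] lies in [M :&: (N <*> K) = 1], so [x] is in
   [N :&: K = 1]. *)
apply/eqP/trivgP; rewrite /= norm_joinEr ?(subset_trans (subset_trans sMT sTG)) //.
apply/subsetP=> x /setIP[Nx /mulsgP[k m Kk Mm def_x]].
have: m \in M :&: (N <*> K).
  rewrite inE Mm -[m](mulKg k) -def_x groupM ?groupV //.
    by rewrite (subsetP (joing_subr _ _)).
  by rewrite (subsetP (joing_subl _ _)).
rewrite tiM => /set1P m1; rewrite -tiNK inE Nx def_x m1 mulg1 //.
Qed.

(** A complement in [T] of the socle part of [N] meets [N] trivially: a minimal normal subgroup of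
    [G] in that intersection would already lie in the socle part. *)
Lemma normal_sub_socle G T N :
    T \subset G -> T \subset socle G T -> N <| G -> N \subset T ->
  N \subset socle G N.
Proof.
move=> sTG socT nsNG sNT.
have s1T := subset_trans (socle_sub G N) sNT.
have ns1G: socle G N <| G by rewrite /normal socle_norm (subset_trans s1T).
have [K [nsKG sKT tiK sT]] := socle_compl sTG socT ns1G s1T.
have defN: socle G N * (K :&: N) = N.
  rewrite group_modl ?socle_sub //; apply/setIidPr; exact: subset_trans sT.
have [KN1 | ntKN] := eqVneq (K :&: N) 1.
  by rewrite -{1}defN KN1 mulg1.
have nKNG: G \subset 'N(K :&: N) by rewrite normsI ?normal_norm.
have [M minM] := minnormal_exists ntKN nKNG.
rewrite subsetI => /andP[sMK sMN].
case/negP: (minnormal_neq1 minM); rewrite -subG1 -tiK subsetI sMK andbT.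
exact: minnormal_socle.
Qed.

Lemma minnormalJ G M x : x \in 'N(G) -> minnormal M G -> minnormal (M :^ x) G.
Proof.
move=> nGx /mingroupP[/andP[ntM nMG] minM]; apply/mingroupP; split.
  by rewrite -(conjs1g x) (inj_eq (@conjsg_inj _ x)) ntM /= -(normP nGx) normJ conjSg.
move=> K /andP[ntK nKG] sKM.
have eqK: K :^ x^-1 = M.
  apply: minM; last by rewrite sub_conjgV.
  rewrite -(conjs1g x^-1) (inj_eq (@conjsg_inj _ _)) ntK /=.
  by rewrite -(normP (groupVr nGx)) normJ conjSg.
by rewrite /= -eqK conjsgKV.
Qed.

(** Clifford's argument: the minimal normal subgroups of [H] in [M] are permuted by [G], so they
    generate a nontrivial subgroup of [M] normalised by [G]. *)
Lemma minnormal_sub_socle G H M :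
  minnormal M G -> M \subset H -> H <| G -> M \subset socle H M.
Proof.
move=> minM sMH /andP[sHG nHG]; have nMG := minnormal_norm minM.
case/mingroupP: (minM) => _ /(_ (socle H M)) <- //; last exact: socle_sub.
have [A minA sAM] := minnormal_exists (minnormal_neq1 minM) (subset_trans sHG nMG).
apply/andP; split.
  apply: contraNneq (minnormal_neq1 minA) => soc1.
  by rewrite -subG1 -soc1 minnormal_socle.
apply/subsetP=> x Gx; rewrite inE /= -genJ gen_subG -bigcupJ.
apply/bigcupsP=> B /andP[sBM minB].
apply: (@minnormal_socle H M (B :^ x)%G); last exact: minnormalJ (subsetP nHG x Gx) minB.
by rewrite -(normsP nMG x Gx) conjSg.
Qed.

Lemma socle_sub_socle G H T :
    T \subset G -> T \subset socle G T -> T \subset H -> H <| G ->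
  T \subset socle H T.
Proof.
move=> sTG socT sTH nsHG; apply: subset_trans socT _.
apply: socle_subP => M sMT minM.
apply: subset_trans (minnormal_sub_socle minM (subset_trans sMT sTH) nsHG) _.
exact: socleS.
Qed.

End Socle.

(** * Quasinilpotent groups *)

Section Quasinilpotent.
Variable gT : finGroupType.
Implicit Types A B C F G H K L M N T U Z : {group gT}.

Lemma normal_TI_cents G A B :
  A <| G -> B <| G -> A :&: B = 1 -> A \subset 'C(B).
Proof.
move=> /andP[sAG nAG] /andP[sBG nBG] tiAB; apply/commG1P/trivgP.
rewrite -tiAB subsetI commg_subl commg_subr.
by rewrite (subset_trans sAG nBG) (subset_trans sBG nAG).
Qed.

(** Chief factors are handled inside [G]: [C] plays the part of the preimage of the centraliser of
    [H / K]. *)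
Lemma quasinilpotentP G :
  quasinilpotent gT G <->
  (forall H K, H <| G -> K <| G -> K \proper H ->
     (forall L, L <| G -> K \subset L -> L \subset H -> L :=: K \/ L :=: H) ->
   exists C, [/\ C \subset G, G \subset H * C & [~: H, C] \subset K]).
Proof.
split=> [/forallP/=qG H K nsHG nsKG ltKH maxK | qG].
  have [[sHG nHG] [sKG nKG]] := (andP nsHG, andP nsKG).
  have nsKH := normalS (proper_sub ltKH) sHG nsKG.
  have /(implyP (forallP (qG H) K)) qHK : Defs.chief_factor gT G H K.
    rewrite /Defs.chief_factor nsHG; apply/maxgroupP; rewrite ltKH nKG.
    split=> // L /andP[/andP[sLH not_sHL] nLG] sKL.
    have [|//|eqL] := maxK L _ sKL sLH; first by rewrite /normal nLG (subset_trans sLH).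
    by rewrite eqL subxx in not_sHL.
  exists (coset K @*^-1 'C_(G / K)(H / K))%G; split=> /=.
  - by rewrite -{2}(quotientGK nsKG) morphpreS ?subsetIl.
  - by rewrite -{1}(quotientGK nsKG) -{1}(quotientGK nsKH) -cosetpreM morphpreS.
  rewrite -quotient_cents2 ?cosetpreK ?(subset_trans sHG nKG) ?morphpre_sub //.
  by rewrite centsC subsetIr.
apply/forallP=> H; apply/forallP=> K; apply/implyP => /andP[nsHG /maxgroupP[]].
case/andP=> ltKH nKG maxK; have [sHG nHG] := andP nsHG.
have sKH := proper_sub ltKH; have sKG := subset_trans sKH sHG.
have [|L /andP[sLG nLG] sKL sLH|C [sCG defG sHCK]] := qG H K nsHG _ ltKH.
- by rewrite /normal sKG.
- have [eqLH | ltLH] := eqVproper sLH; first by right.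
  by left; apply: maxK; rewrite ?ltLH.
rewrite (subset_trans (quotientS K defG)) // quotientMl ?(subset_trans sHG) //.
rewrite mulgS // subsetI quotientS //= centsC quotient_cents2 //.
  exact: subset_trans nKG.
exact: subset_trans nKG.
Qed.

Lemma socular_quasinilpotent G : G \subset socle G G -> quasinilpotent gT G.
Proof.
move=> socG; apply/quasinilpotentP=> H K nsHG nsKG _ _.
have [C [nsCG sCG tiHC defG]] := socle_compl (subxx G) socG nsHG (normal_sub nsHG).
exists C; split=> //; apply: subset_trans (sub1G K).
by rewrite subG1; apply/eqP/commG1P/(normal_TI_cents nsHG nsCG).
Qed.

Lemma quasinilpotent_minnormal G A :
  quasinilpotent gT G -> A \subset G -> minnormal A G -> G \subset A * 'C_G(A).
Proof.
move/quasinilpotentP=> qG sAG minA; have nAG := minnormal_norm minA.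
have [|||L /andP[_ nLG] _ sLA|C [sCG defG sAC]] := qG A 1%G.
- by rewrite /normal sAG.
- exact: normal1.
- by rewrite proper1G (minnormal_neq1 minA).
- have [sAL | tiAL] := minnormal_subVTI minA nLG.
    by right; apply/eqP; rewrite eqEsubset sLA.
  by left; rewrite -(setIidPr sLA).
apply: subset_trans defG _; rewrite mulgS // subsetI sCG centsC.
by apply/commG1P/trivgP.
Qed.

(** A normal [B] in [T] maximal with [G = B * 'C_G(B)] is all of [T], since it could be enlarged by
    any minimal normal subgroup that it avoids. *)
Lemma quasinilpotent_socle G T :
    quasinilpotent gT G -> T \subset G -> T \subset socle G T ->
  G \subset T * 'C_G(T).
Proof.
move=> qG sTG socT.
pose P B := [&& B <| G, B \subset T & G \subset B * 'C_G(B)].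
have [|B /maxgroupP[/and3P[nsBG sBT defG] maxB] _] := @maxgroup_exists _ P 1.
  by rewrite /P normal1 sub1G /= mul1g cent1T setIT.
suffices eqBT: B :=: T by rewrite -eqBT.
apply/eqP; rewrite eqEsubset sBT (subset_trans socT) //.
apply: socle_subP => A sAT minA; have nAG := minnormal_norm minA.
have sAG := subset_trans sAT sTG; have [sBG nBG] := andP nsBG.
have [//|tiAB] := minnormal_subVTI minA nBG.
have nsAG: A <| G by rewrite /normal sAG.
have cAB := normal_TI_cents nsAG nsBG tiAB.
rewrite -(maxB (B <*> A)%G) ?joing_subl ?joing_subr //.
rewrite /P normalY //= join_subG sBT sAT /= norm_joinEr ?(subset_trans sAG) //.
rewrite centM setIA.
have defGA := quasinilpotent_minnormal qG sAG minA.
(* Write [g = b * c] and [c = a * d]. Both [c] and [a] centralise [B], so [d] centralises [B] as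
   well as [A]. *)
apply/subsetP=> g Gg; have /mulsgP[b c Bb /setIP[Gc cBc] ->] := subsetP defG g Gg.
have /mulsgP[a d Aa /setIP[Gd cAd] def_c] := subsetP defGA c Gc.
rewrite def_c mulgA !mem_mulg // !inE Gd cAd andbT /=.
by rewrite -[d](mulKg a) -def_c groupM // groupV (subsetP cAB).
Qed.

End Quasinilpotent.

(** * Central extensions, images and products of quasinilpotent groups *)

Section QuasinilpotentExtensions.
Variable gT : finGroupType.
Implicit Types A B C F G H K L M N T U Z : {group gT}.

(** A chief factor [H / K] either is covered by [Z], hence central, or satisfies
    [H :&: (K <*> Z) = K] and then corresponds to a chief factor of [G / Z]. *)
Lemma quasinilpotent_central_ext G Z :
  Z \subset 'Z(G) -> quasinilpotent _ (G / Z)%G -> quasinilpotent gT G.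
Proof.
rewrite subsetI => /andP[sZG cZG] /quasinilpotentP qGZ.
have nsZG: Z <| G by rewrite /normal sZG cents_norm // centsC.
have nZG := normal_norm nsZG.
apply/quasinilpotentP=> H K nsHG nsKG ltKH maxK.
have [[sHG nHG] [sKG nKG]] := (andP nsHG, andP nsKG).
have [nZH nZK] := (subset_trans sHG nZG, subset_trans sKG nZG).
have nsKZ: K <*> Z <| G by rewrite normalY.
have := maxK (H :&: (K <*> Z))%G; rewrite /= normalI // subsetIl.
rewrite subsetI (proper_sub ltKH) joing_subl => /(_ isT isT isT)[]; last first.
  move/setIidPl=> sHKZ; exists G; split; rewrite ?mulG_subr //.
  rewrite -quotient_cents2 //; last exact: subset_trans nKG.
  apply: subset_trans (quotientS K sHKZ) _.
  by rewrite quotientYidl ?quotient_cents // (subset_trans sZG).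
move=> tiH.
have [|||Lb|] := qGZ (H / Z)%G (K / Z)%G.
- exact: quotient_normal.
- exact: quotient_normal.
- rewrite properE quotientS ?(proper_sub ltKH) //=; apply: contraL ltKH.
  rewrite quotientSK // -norm_joinEr // joingC => sHKZ.
  by rewrite -tiH (setIidPl sHKZ) properxx.
- case/(inv_quotientN nsZG)=> L -> sZL nsLG.
  have sLG := normal_sub nsLG; have nZL := subset_trans sLG nZG.
  rewrite /= quotientSK // quotientSK // => sKL sLH.
  have defL: Z * (H :&: L) = L.
    by rewrite group_modl //; apply/setIidPr.
  have := maxK (H :&: L)%G; rewrite /= normalI // subsetI subsetIl.
  rewrite (proper_sub ltKH) (subset_trans sKL) ?mul_subG // => /(_ isT isT isT).
  by case=> eqHL; [left | right]; rewrite -defL eqHL quotientMidl.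
move=> Cb [/inv_quotientS[|C -> sZC sCG]]; first exact: nsZG.
have nZC := subset_trans sCG nZG.
rewrite /= -quotientMl // quotientSK // => sGHC; rewrite -quotientR // quotientSK //.
  move=> sHC; exists C; split=> //.
    apply: subset_trans sGHC _.
    by rewrite mulgA -(normC nZH) -mulgA (mulSGid sZC).
  rewrite -tiH subsetI commg_subl (subset_trans sCG nHG) norm_joinEl //.
  by rewrite normC.
by apply: subset_trans nZG; rewrite comm_subG.
Qed.

End QuasinilpotentExtensions.

Lemma quasinilpotent_morphim (aT rT : finGroupType) (G : {group aT})
    (f : {morphism G >-> rT}) :
  quasinilpotent aT G -> quasinilpotent rT (f @* G)%G.
Proof.
move/quasinilpotentP=> qG; apply/quasinilpotentP=> H K nsHG nsKG ltKH maxK.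
have [sHG sKG] := (normal_sub nsHG, normal_sub nsKG).
have defG: f @*^-1 (f @* G) = G by rewrite morphimGK ?subsetIl.
have nsPre L : L <| f @* G -> f @*^-1 L <| G.
  by move=> nsL; have := morphpre_normal (normal_sub nsL) (subxx (f @* G)); rewrite defG nsL.
have [|||L nsLG sKL sLH|C [sCG sGHC sHCK]] := qG (f @*^-1 H)%G (f @*^-1 K)%G.
- exact: nsPre.
- exact: nsPre.
- by rewrite /= morphpre_proper.
- have defL: f @*^-1 (f @* L) = L.
    rewrite morphimGK ?(normal_sub nsLG) //; apply: subset_trans sKL.
    by rewrite /= kerE morphpreS ?sub1G.
  have sKfL: K \subset f @* L by rewrite -(morphpreK sKG) morphimS.
  have sfLH: f @* L \subset H by rewrite sub_morphim_pre ?(normal_sub nsLG).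
  have := maxK (f @* L)%G (morphim_normal f nsLG) sKfL sfLH.
  by move=> [] /= eqL; [left | right]; rewrite -eqL defL.
exists (f @* C)%G; split=> /=.
- exact: morphimS.
- rewrite -{1}(morphpreK sHG) -morphimMl ?morphimS //; exact: subsetIl.
rewrite -{1}(morphpreK sHG) -morphimR //; last exact: subsetIl.
by rewrite sub_morphim_pre // comm_subG // subsetIl.
Qed.

Lemma quasinilpotent_morphim_sub (aT rT : finGroupType) (D G : {group aT})
    (f : {morphism D >-> rT}) :
  G \subset D -> quasinilpotent aT G -> quasinilpotent rT (f @* G)%G.
Proof.
move=> sGD qG; have := @quasinilpotent_morphim _ _ _ [morphism of restrm sGD f] qG.
by congr quasinilpotent; apply/group_inj; rewrite /= morphim_restrm setIid.
Qed.

Lemma quasinilpotent_quotient (gT : finGroupType) (G N : {group gT}) :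
  G \subset 'N(N) -> quasinilpotent gT G -> quasinilpotent _ (G / N)%G.
Proof.
exact: quasinilpotent_morphim_sub.
Qed.

(** For a chief factor [A / B] each generator [H] is treated alone: its image contains [A / B],
    which is completely reducible under it by Clifford, or meets [A / B] trivially and centralises
    it. *)
Lemma quasinilpotent_gen (gT : finGroupType) (G : {group gT}) (P : pred {group gT}) :
    G :=: << \bigcup_(H : {group gT} | P H) H >> ->
    (forall H : {group gT}, P H -> H <| G /\ quasinilpotent gT H) ->
  quasinilpotent gT G.
Proof.
move=> defG nqP; apply/forallP=> A; apply/forallP=> B; apply/implyP=> /andP[nsAG maxB].
have minA: minnormal (A / B) (G / B).
  by apply: chief_factor_minnormal; rewrite /gseries.chief_factor maxB.
have [/andP[_ nBG] _] := maxgroupP maxB.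
rewrite -norm_joinEr ?cents_norm ?subsetIr // sub_quotient_pre //.
rewrite {1}defG gen_subG; apply/bigcupsP=> H PH; have [nsHG qH] := nqP H PH.
have nBH := subset_trans (normal_sub nsHG) nBG.
rewrite -sub_quotient_pre //.
have nsHb := quotient_normal B nsHG.
have [sAH | tiAH] := @minnormal_subVTI _ _ (A / B)%G (H / B)%G minA (normal_norm nsHb).
  rewrite /= norm_joinEr ?cents_norm ?subsetIr //.
  have := quasinilpotent_socle (quasinilpotent_quotient nBH qH) sAH
            (minnormal_sub_socle (M := (A / B)%G) minA sAH nsHb).
  by move/subset_trans; apply; rewrite mulgS // setSI // normal_sub.
rewrite (subset_trans _ (joing_subr _ _)) // subsetI normal_sub // centsC.
by apply: (normal_TI_cents (quotient_normal B nsAG) nsHb).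
Qed.

(** * Functorials compatible with epimorphisms *)

(** F1 for an injective morphism and for its inverse shows that both sides have the same order. *)
Lemma F1_functorial (g : fmap) :
  (forall gT G, g gT G \subset G) -> F1 g -> functorial g.
Proof.
move=> sg g1; split=> [gT G | aT rT G f injf]; last first.
  apply/eqP; rewrite eqEcard g1 card_injm ?sg //.
  have := subset_leq_card (g1 _ _ _ (invm_morphism injf)).
  rewrite card_injm ?injm_invm ?sg //.
  have -> : (invm injf @* (f @* G))%G = G by apply: group_inj; rewrite /= morphim_invm.
  exact.
apply/charP; split=> // f injf fG; apply/eqP.
rewrite eqEcard card_injm ?sg // leqnn andbT.
have eqG : (f @* G)%G = G by apply: group_inj.
by have := g1 _ _ _ f; rewrite eqG.
Qed.

Lemma F1_sub (g : fmap) (aT rT : finGroupType) (D G : {group aT})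
    (f : {morphism D >-> rT}) :
    F1 g -> (forall gT G, g gT G \subset G) -> G \subset D ->
  f @* g aT G \subset g rT (f @* G)%G.
Proof.
move=> g1 sg sGD; have := g1 _ _ _ [morphism of restrm sGD f].
rewrite /= morphim_restrm (setIidPr (sg _ _)).
by have -> : (restrm sGD f @* G)%G = (f @* G)%G
  by apply: group_inj; rewrite /= morphim_restrm setIid.
Qed.

(** Since [f] kills [N], it factors through [G / N], and F1 applies to the factor morphism. *)
Lemma F1_quotient (g : fmap) (aT rT : finGroupType) (D G N : {group aT})
    (f : {morphism D >-> rT}) :
    F1 g -> (forall gT G, g gT G \subset G) -> G \subset D -> N <| G ->
    f @* N = 1 ->
  f @* (coset N @*^-1 g _ (G / N)%G) \subset g rT (f @* G)%G.
Proof.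
move=> g1 sg sGD nsNG fN1; have nNG := normal_norm nsNG.
pose q := [morphism of restrm nNG (coset N)].
pose h := [morphism of restrm sGD f].
have skk: 'ker q \subset 'ker h.
  rewrite /= !ker_restrm ker_coset setIS // kerE.
  by rewrite -sub_morphim_pre ?fN1 // (subset_trans (normal_sub nsNG)).
have im_h (A : {set aT}) : A \subset G -> h @* A = f @* A.
  by move=> sAG; rewrite morphim_restrm (setIidPr sAG).
have sXG: coset N @*^-1 g _ (G / N)%G \subset G.
  by apply: subset_trans (morphpreS _ (sg _ _)) _; rewrite /= quotientGK.
have := g1 _ _ _ [morphism of factm skk (subxx G)].
have -> : (factm skk (subxx G) @* (q @* G))%G = (f @* G)%G.
  by apply: group_inj; rewrite /= morphim_factm im_h.
apply: subset_trans; rewrite /=.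
have -> : (q @* G)%G = (G / N)%G.
  by apply: group_inj; rewrite /= morphim_restrm setIid.
have {2}-> : gval (g _ (G / N)%G) = q @* (coset N @*^-1 g _ (G / N)%G).
  by rewrite morphim_restrm (setIidPr sXG); apply/esym/cosetpreK.
by rewrite morphim_factm im_h.
Qed.

(** The form of F1 for preimages of quotients: it serves [Ftilde] with [g = Soc] and Frattini
    subgroups, and [fstar] with the values of a Frattini functorial. *)
Lemma F1_lift (g : fmap) (aT rT : finGroupType) (D G N : {group aT})
    (P : {group rT}) (f : {morphism D >-> rT}) :
    F1 g -> (forall gT G, g gT G \subset G) -> G \subset D -> N <| G ->
    f @* G \subset 'N(P) -> f @* N \subset P ->
  f @* (coset N @*^-1 g _ (G / N)%G) \subset coset P @*^-1 g _ (f @* G / P)%G.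
Proof.
move=> g1 sg sGD nsNG nPG fNP.
have sXG: coset N @*^-1 g _ (G / N)%G \subset G.
  by apply: subset_trans (morphpreS _ (sg _ _)) _; rewrite /= quotientGK.
rewrite -sub_quotient_pre; last by apply: subset_trans nPG; apply: morphimS.
have sGE: G \subset f @*^-1 'N(P) by rewrite -sub_morphim_pre.
have := @F1_quotient g _ _ _ G N (comp_morphism f (coset_morphism P)) g1 sg sGE nsNG.
rewrite /= !morphim_comp; have -> : (comp_morphism f (coset_morphism P) @* G)%G = (f @* G / P)%G.
  by apply: group_inj; rewrite /= morphim_comp.
by apply; apply: quotientS1.
Qed.

(** * The functorials F* and F~ *)

Section Fstar.
Variable gT : finGroupType.
Implicit Types C G H K M N R Z : {group gT}.

Lemma Fstar_max G H : H <| G -> quasinilpotent gT H -> H \subset Fstar gT G.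
Proof. by move=> nsHG qH; rewrite sub_gen // (bigcup_sup H) ?nsHG. Qed.

Lemma Fstar_normal G : Fstar gT G <| G.
Proof.
rewrite /normal gen_subG; apply/andP; split.
  by apply/bigcupsP=> H /andP[/normal_sub].
by apply/norms_gen/norms_bigcup/bigcapsP=> H /andP[/normal_norm].
Qed.

Lemma Fstar_sub G : Fstar gT G \subset G.
Proof. exact: normal_sub (Fstar_normal G). Qed.

Lemma Fstar_quasinilpotent G : quasinilpotent gT (Fstar gT G).
Proof.
apply: (@quasinilpotent_gen _ _ (fun H => (H <| G) && quasinilpotent gT H)) => //.
move=> H /andP[nsHG qH]; split=> //.
exact: normalS (Fstar_max nsHG qH) (Fstar_sub G) nsHG.
Qed.

End Fstar.

Lemma Fstar_F1 : F1 Fstar.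
Proof.
move=> gT rT G f; apply: Fstar_max; first exact: morphim_normal (Fstar_normal G).
exact: quasinilpotent_morphim_sub (Fstar_sub G) (Fstar_quasinilpotent G).
Qed.

Lemma Fstar_functorial : functorial Fstar.
Proof. by apply: F1_functorial Fstar_F1 => gT G; apply: Fstar_sub. Qed.

Lemma Fstar_F2 : F2 Fstar.
Proof.
move=> gT G N nsNG; apply: Fstar_max (Fstar_quasinilpotent N).
by apply: char_normal_trans nsNG; have [+ _] := Fstar_functorial; apply.
Qed.

(** If ['C_G(F) / Z] were nontrivial, a minimal normal subgroup [M / Z] of [G / Z] inside it would
    give a central extension [M] of a completely reducible group. Such an [M] is quasinilpotent, so
    it lies in [F] and hence in [Z]. *)
Lemma Fstar_F3 : F3 Fstar.
Proof.
move=> gT G; set F := Fstar gT G; have nsFG : F <| G := Fstar_normal G.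
have nsCG : 'C_G(F) <| G by rewrite /normal subsetIl normsI ?normG ?norms_cent ?normal_norm.
pose Z := ('C_G(F) :&: F)%G; have nsZG : Z <| G by apply: normalI.
have nZG := normal_norm nsZG.
apply/setIidPl/eqP; rewrite eqEsubset subsetIl -[_ :&: F]/(gval Z) /=.
have nZC : 'C_G(F) \subset 'N(Z) by apply: subset_trans nZG; apply: subsetIl.
rewrite -quotient_sub1 // subG1; apply/idPn => ntCZ.
have [Mb minMb sMbC] := @minnormal_exists _ (G / Z)%G ('C_G(F) / Z)%G ntCZ
  (normal_norm (quotient_normal Z nsCG)).
have sMbG : Mb \subset G / Z by apply: subset_trans sMbC _; apply: quotientS (subsetIl _ _).
have nsMbG : Mb <| G / Z by rewrite /normal sMbG minnormal_norm.
have [M defMb sZM nsMG] := inv_quotientN nsZG nsMbG.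
have sMC : M \subset 'C_G(F).
  by rewrite -(quotientSGK _ (subsetIl _ F : Z \subset 'C_G(F))) -?defMb //
    (subset_trans (normal_sub nsMG)).
have [_ cMF] := subsetIP sMC.
have qM : quasinilpotent gT M.
  apply: (@quasinilpotent_central_ext _ _ Z).
    rewrite subsetI sZM; apply: subset_trans (subsetIr _ _) _.
    by rewrite centsC.
  have -> : (M / Z)%G = Mb by apply: group_inj.
  by apply: socular_quasinilpotent; apply: minnormal_sub_socle minMb _ nsMbG.
have sMZ : M \subset Z by rewrite subsetI sMC Fstar_max.
by case/eqP: (minnormal_neq1 minMb); rewrite defMb; apply: quotientS1.
Qed.

(** * Quasinilpotent normal subgroups of Frattini-free groups *)

Section FrattiniFree.
Variable gT : finGroupType.
Implicit Types C G H K M N R Z : {group gT}.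

Lemma Phi1_supplement G N : 'Phi(G) = 1 -> N \subset G -> N :!=: 1 ->
  exists2 M : {group gT}, maximal M G & ~~ (N \subset M).
Proof.
move=> Phi1 sNG ntN;
have [/existsP[M /andP[]] | ] := boolP [exists M : {group gT}, maximal M G && ~~ (N \subset M)].
  by exists M.
rewrite negb_exists => /forallP maxN; case/negP: ntN; rewrite -subG1 -Phi1.
apply/bigcapsP=> M /predU1P[->//|maxM].
by have := maxN M; rewrite maxM negbK.
Qed.

Lemma normal_maximal_mul G N M :
  N <| G -> maximal M G -> ~~ (N \subset M) -> N * M = G.
Proof.
case/andP=> sNG nNG /maxgroupP[/andP[sMG _] maxM] not_sNM.
have nNM := subset_trans sMG nNG.
apply/eqP; rewrite eqEproper mul_subG // -norm_joinEr //.
by apply: contra not_sNM => /maxM <-; rewrite ?joing_subl ?joing_subr.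
Qed.

(** Let [N] be minimal among the normal subgroups of [G] in [H] outside the socle, and [R] its part
    in the socle. Then [R] is central in [N], and a maximal subgroup not containing [R] splits [N]
    into smaller normal subgroups, a contradiction. *)
Lemma quasinilpotent_sub_Soc G H :
  'Phi(G) = 1 -> H <| G -> quasinilpotent gT H -> H \subset Soc gT G.
Proof.
move=> Phi1 nsHG qH; apply/idPn => not_sHS.
pose P N := [&& N <| G, N \subset H & ~~ (N \subset Soc gT G)].
have [|N /mingroupP[/and3P[nsNG sNH not_sNS] minN] _] := @mingroup_exists _ P H.
  by rewrite /P nsHG subxx.
have {}minN (L : {group gT}) : L <| G -> L \subset N -> L \subset Soc gT G \/ L :=: N.
  move=> nsLG sLN; have [|not_sLS] := boolP (L \subset Soc gT G); [by left | right].
  by apply: minN; rewrite /P ?nsLG ?not_sLS ?(subset_trans sLN).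
pose R := (N :&: Soc gT G)%G; have sRN : R \subset N := subsetIl _ _.
have [sSG nSG] := andP (Soc_normal G); have [sNG nNG] := andP nsNG.
have nsRG : R <| G by rewrite normalI ?Soc_normal.
have [sRG nRG] := andP nsRG.
have socR := normal_sub_socle sSG (Soc_socle G) nsRG (subsetIr _ _).
have sRH := subset_trans sRN sNH.
have defH := quasinilpotent_socle qH sRH (socle_sub_socle sRG socR sRH nsHG).
pose C := 'C_N(R)%G.
have defN : N \subset R * C.
  apply/subsetP=> x Nx;
  have /mulsgP[r c Rr /setIP[Hc cRc] def_x] := subsetP defH x (subsetP sNH x Nx).
  rewrite def_x mem_mulg // inE cRc andbT -[c](mulKg r) -def_x groupM //.
  by rewrite groupV (subsetP sRN).
have nsCG : C <| G by rewrite /normal normsI ?norms_cent // subIset ?sNG.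
(* If [C] is in the socle, so is [N = R * C]; otherwise [C = N], and [R] is central in [N]. *)
have [sCS | /setIidPl cNR] := minN C nsCG (subsetIl _ _).
  case/negP: not_sNS; apply: subset_trans defN _.
  by rewrite mul_subG // subsetIr.
have ntR : R :!=: 1.
  apply: contraNneq not_sNS => R1; have [->|ntN] := eqVneq (gval N) 1; first exact: sub1G.
  have [M minM sMN] := minnormal_exists ntN nNG.
  have sMS : M \subset Soc gT G by apply: (@minnormal_socle _ G G) => //; apply: subset_trans sNG.
  by case/negP: (minnormal_neq1 minM); rewrite -subG1 -R1 subsetI sMN.
have [M maxM not_sRM] := Phi1_supplement Phi1 sRG ntR.
have defG := normal_maximal_mul nsRG maxM not_sRM.
(* [M] normalises [N :&: M] and [R] centralises it, so [G = R * M] normalises it. *)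
have nsNMG : N :&: M <| G.
  rewrite /normal subIset ?sNG //= -{1}defG mul_subG //; last first.
    rewrite normsI ?normG // (subset_trans _ nNG) //.
    by rewrite -defG mulG_subr.
  by apply: cents_norm; rewrite centsC (subset_trans (subsetIl _ _)).
have [sNMS | eqNM] := minN (N :&: M)%G nsNMG (subsetIl _ _).
  case/negP: not_sNS; apply: subset_trans (subsetIr N _).
  have defN' : N :=: R * (N :&: M).
    by rewrite setIC group_modl // setIC defG; apply/esym/setIidPl.
  by rewrite {1}defN' mul_subG // subsetI subsetIl.
by case/negP: not_sRM; rewrite (subset_trans sRN) // -eqNM subsetIr.
Qed.

End FrattiniFree.

(** * The socle, the Frattini subgroup and [Ftilde] under morphisms and normal subgroups *)

Lemma Soc_sub gT (G : {group gT}) : Soc gT G \subset G.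
Proof. exact: normal_sub (Soc_normal G). Qed.

Lemma Soc_F1 : F1 Soc.
Proof.
move=> gT rT G f; rewrite morphim_gen; last by apply/bigcupsP=> M /andP[].
rewrite gen_subG sub_morphim_pre; last by apply/bigcupsP=> M /andP[].
apply/bigcupsP=> M /andP[sMG minM]; rewrite -sub_morphim_pre //.
have nMG := minnormal_norm minM.
have [-> | ntfM] := eqVneq (f @* M) 1; first exact: sub1G.
apply: (@minnormal_socle _ (f @* G)%G (f @* G)%G (f @* M)%G); first exact: morphimS.
apply/mingroupP; split=> [|L /andP[ntL nLG] sLM]; first by rewrite ntfM morphim_norms.
have nLG' : G \subset 'N(f @*^-1 L).
  by have := morphpre_norms f nLG; rewrite morphimGK ?subsetIl.
have := morphim_setIpre f M L; rewrite (setIidPr sLM).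
have [sML <- | /= ->] := minnormal_subVTI minM nLG'; first by rewrite (setIidPl sML).
by rewrite morphim1 => L1; rewrite L1 eqxx in ntL.
Qed.

Lemma Soc_functorial : functorial Soc.
Proof. exact: F1_functorial Soc_sub Soc_F1. Qed.

Lemma Soc_quasinilpotent gT (G : {group gT}) : quasinilpotent gT (Soc gT G).
Proof.
exact/socular_quasinilpotent/(socle_sub_socle (Soc_sub G) (Soc_socle G) _ (Soc_normal G)).
Qed.

Lemma Soc_normalS gT (G N : {group gT}) :
  'Phi(G) = 1 -> N <| G -> Soc gT N \subset Soc gT G.
Proof.
move=> Phi1 nsNG; apply: quasinilpotent_sub_Soc (Soc_quasinilpotent N) => //.
by apply: char_normal_trans nsNG; have [+ _] := Soc_functorial; apply.
Qed.

Lemma lift_sub (g : fmap) (gT : finGroupType) (G N : {group gT}) :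
    (forall gT G, g gT G \subset G) -> N <| G ->
  coset N @*^-1 g _ (G / N)%G \subset G.
Proof.
by move=> sg nsNG; apply: subset_trans (morphpreS _ (sg _ _)) _; rewrite /= quotientGK.
Qed.

(** If a maximal [M] does not contain ['Phi(N)], then [G = 'Phi(N) * M], and Dedekind's law makes
    [N] generated by ['Phi(N)] and [N :&: M]; so [N] lies in [M]. *)
Lemma Phi_normalS (gT : finGroupType) (G N : {group gT}) :
  N <| G -> 'Phi(N) \subset 'Phi(G).
Proof.
move=> nsNG; apply/bigcapsP=> M /predU1P[-> | maxM].
  exact: subset_trans (Phi_sub N) (normal_sub nsNG).
apply/idPn => not_sPM.
have nsPG : 'Phi(N) <| G by apply: char_normal_trans nsNG; apply: Phi_char.
have defG := normal_maximal_mul nsPG maxM not_sPM.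
have: 'Phi(N) <*> (N :&: M) = N.
  rewrite norm_joinEr; last by rewrite (subset_trans (subsetIl _ _)) // normal_norm ?Phi_normal.
  rewrite /= setIC group_modl ?Phi_sub // [_ * _]defG.
  by apply/setIidPr/normal_sub.
move/Phi_nongen; rewrite genGid => /setIidPl sNM.
by case/negP: not_sPM; apply: subset_trans sNM; apply: Phi_sub.
Qed.

Lemma Ftilde_normal (gT : finGroupType) (G : {group gT}) : Ftilde gT G <| G.
Proof.
rewrite -(quotientGK (Phi_normal G)) cosetpre_normal; exact: Soc_normal.
Qed.

Lemma Ftilde_sub (gT : finGroupType) (G : {group gT}) : Ftilde gT G \subset G.
Proof. exact: normal_sub (Ftilde_normal G). Qed.

Lemma Ftilde_F1 : F1 Ftilde.
Proof.
move=> aT rT G f; apply: (F1_lift (g := Soc)) => //.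
- exact: Soc_F1.
- exact: Soc_sub.
- exact: Phi_normal.
- exact: normal_norm (Phi_normal _).
exact: Frattini_continuous.
Qed.

(** F1 along [N / M -> N / P] reduces the comparison to quotients by the same subgroup [P]. *)
Lemma F2_lift (g : fmap) (gT : finGroupType) (G N M P : {group gT}) :
    F1 g -> (forall gT G, g gT G \subset G) ->
    N <| G -> M <| N -> P <| G -> M \subset P ->
    g _ (N / P)%G \subset g _ (G / P)%G ->
  coset M @*^-1 g _ (N / M)%G \subset coset P @*^-1 g _ (G / P)%G.
Proof.
move=> g1 sg nsNG nsMN nsPG sMP sgNG.
have sMG := subset_trans (normal_sub nsMN) (normal_sub nsNG).
have sNG := normal_sub nsNG.
have idN : (idm_morphism G @* N)%G = N by apply: group_inj; rewrite /= morphim_idm.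
have := @F1_lift g _ _ G N M P (idm_morphism G) g1 sg sNG nsMN.
have sXG := subset_trans (lift_sub sg nsMN) sNG.
rewrite idN !morphim_idm // => sNM.
apply: subset_trans (sNM _ sMP) _; last by rewrite morphpreS.
exact: subset_trans sNG (normal_norm nsPG).
Qed.

Lemma Ftilde_F2 : F2 Ftilde.
Proof.
move=> gT G N nsNG; apply: (F2_lift (g := Soc)) (Phi_normalS nsNG) _ => //.
- exact: Soc_F1.
- exact: Soc_sub.
- exact: Phi_normal.
- exact: Phi_normal.
by apply: Soc_normalS; rewrite ?quotient_normal //= Phi_quotient_id.
Qed.

Lemma Fstar_le_Ftilde : fle Fstar Ftilde.
Proof.
move=> gT G; have nPF := subset_trans (Fstar_sub G) (normal_norm (Phi_normal G)).
rewrite -sub_quotient_pre //.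
apply: (@quasinilpotent_sub_Soc _ (G / 'Phi(G))%G (Fstar gT G / 'Phi(G))%G).
- exact: Phi_quotient_id.
- exact: quotient_normal (Fstar_normal G).
by apply: (quasinilpotent_quotient (N := [group of 'Phi(G)])) => //; apply: Fstar_quasinilpotent.
Qed.

Lemma nilpotent_quasinilpotent (gT : finGroupType) (G : {group gT}) :
  nilpotent G -> quasinilpotent gT G.
Proof.
move=> nilG; apply/forallP=> A; apply/forallP=> B; apply/implyP=> /andP[nsAG maxB].
have minA: minnormal (A / B) (G / B).
  by apply: chief_factor_minnormal; rewrite /gseries.chief_factor maxB.
have [sAZ | tiAZ] := @minnormal_subVTI _ _ (A / B)%G 'Z(G / B)%G minA (gFnorm _ _).
  rewrite (subset_trans _ (mulG_subr _ _)) // subsetI subxx /= centsC.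
  by apply: subset_trans sAZ _; apply: subsetIr.
case/negP: (minnormal_neq1 (M := (A / B)%G) minA); apply/eqP.
by apply: (TI_center_nil (quotient_nil B nilG)) tiAZ; apply: quotient_normal.
Qed.

(** * Bounds on F-functorials *)

Lemma quasinilpotent_chief (gT : finGroupType) (G A : {group gT}) :
    quasinilpotent gT G -> A <| G -> A :!=: 1 ->
  exists B C : {group gT},
    [/\ B <| G, B \proper A, C <| G, G \subset A * C & [~: A, C] \subset B].
Proof.
move=> qG nsAG ntA; have [sAG nAG] := andP nsAG.
have [|B maxB _] := @maxgroup_exists _ (fun B : {group gT} => (B \proper A) && (G \subset 'N(B))) 1.
  by rewrite proper1G ntA norms1.
have [/andP[ltBA nBG] _] := maxgroupP maxB; have sBA := proper_sub ltBA.
have nsBG : B <| G by rewrite /normal (subset_trans sBA).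
have nsBA := normalS sBA sAG nsBG.
have cfAB : Defs.chief_factor gT G A B by rewrite /Defs.chief_factor nsAG.
have /implyP/(_ cfAB) defG := forallP (forallP qG A) B.
exists B, (coset B @*^-1 'C_(G / B)(A / B))%G; split=> //=.
- rewrite -[X in _ <| X](quotientGK nsBG) cosetpre_normal /normal subsetIl /=.
  by rewrite normsI ?normG ?norms_cent ?quotient_norms.
- by rewrite -{1}(quotientGK nsBG) -{1}(quotientGK nsBA) -cosetpreM morphpreS.
rewrite -quotient_cents2 ?cosetpreK ?(subset_trans sAG nBG) ?morphpre_sub //.
by rewrite centsC subsetIr.
Qed.

(** Induction on the order of [A]: if [B] lies in ['Z_k(N)], then [[~: A, N] \subset B] puts [A] in
    the next term. *)
Lemma sub_ucn (gT : finGroupType) (G N R : {group gT}) :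
    R \subset N -> R <| G ->
    (forall A : {group gT}, A <| G -> A \subset R -> A :!=: 1 ->
      exists B : {group gT}, [/\ B <| G, B \proper A & [~: A, N] \subset B]) ->
  exists k, R \subset 'Z_k(N).
Proof.
move=> sRN nsRG cR.
suffices cA m (A : {group gT}) : #|A| < m -> A <| G -> A \subset R -> exists k, A \subset 'Z_k(N).
  exact: (cA #|R|.+1).
elim: m A => // m IHm A leAm nsAG sAR.
have [-> | ntA] := eqVneq (gval A) 1; first by exists 0; apply: sub1G.
have [B [nsBG ltBA sANB]] := cR A nsAG sAR ntA.
have [|//||k sBZ] := IHm B.
- exact: leq_trans (proper_card ltBA) leAm.
- exact: subset_trans (proper_sub ltBA) sAR.
exists k.+1; rewrite ucnSnR; apply/subsetP=> x Ax.
rewrite inE (subsetP sRN) ?(subsetP sAR) //= (subset_trans _ sBZ) //.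
by apply: subset_trans sANB; rewrite commSg // sub1set.
Qed.

Lemma perfect_ucn (gT : finGroupType) (N : {group gT}) k :
  N^`(1) = N -> 'Z_k(N) \subset 'Z(N).
Proof.
move=> perfN; elim: k => [|k IHk]; first exact: sub1G.
have cZ : [~: [~: 'Z_k.+1(N), N], N] :=: 1.
  apply/commG1P; apply: subset_trans (ucn_comm k N) _.
  exact: subset_trans IHk (subsetIr _ _).
rewrite subsetI ucn_sub; apply/commG1P; rewrite commGC.
rewrite -{1}perfN derg1.
by apply: (three_subgroup (G := N) (H := [group of 'Z_k.+1(N)]) (K := N));
  rewrite // [[~: N, _]]commGC.
Qed.

Lemma F2_subnormal (g : fmap) (gT : finGroupType) (G H : {group gT}) :
  F2 g -> H <|<| G -> g gT H \subset g gT G.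
Proof.
move=> g2; have [m] := ubnP #|G|; elim: m G => // m IHm G leGm snHG.
have [eqHG | [K [snHK nsKG ltKG]]] := subnormalEr snHG.
  by rewrite (group_inj eqHG).
apply: subset_trans (g2 _ _ _ nsKG); apply: IHm snHK.
exact: leq_trans (proper_card ltKG) leGm.
Qed.

(** Cyclic subgroups are subnormal, and F3 forces [g] to fix them because they are abelian. *)
Lemma functorial_nilpotent (g : fmap) (gT : finGroupType) (G : {group gT}) :
  functorial g -> F2 g -> F3 g -> nilpotent G -> g gT G :=: G.
Proof.
move=> [g0 _] g2 g3 nilG; apply/eqP; rewrite eqEsubset char_sub // .
apply/subsetP=> x Gx; have sxG : <[x]> \subset G by rewrite cycle_subG.
apply: (subsetP (F2_subnormal g2 (nilpotent_subnormal (H := <[x]>%G) nilG sxG))).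
rewrite (subsetP (g3 _ _)) // inE cycle_id /=.
apply: (subsetP (centS (char_sub (g0 _ <[x]>%G)))).
exact: (subsetP (cycle_abelian x)) (cycle_id x).
Qed.

(** The claim covers all normal subgroups of [G], so that a minimal counterexample can be taken
    inside one fixed quasinilpotent group. *)
Lemma functorial_quasinilpotent (g : fmap) (gT : finGroupType) (G N : {group gT}) :
    functorial g -> F2 g -> F3 g -> quasinilpotent gT G -> N <| G ->
  g gT N :=: N.
Proof.
move=> fg g2 g3 qG nsNG; apply/eqP/idPn => neN; have g0 := fg.1.
pose P (N : {group gT}) := (N <| G) && (g gT N != N :> {set gT}).
have [|M /mingroupP[/andP[nsMG neM] minM] _] := @mingroup_exists _ P N.
  by rewrite /P nsNG.
move: {N} M nsMG neM minM {nsNG neN} => N nsNG neN minN.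
set R := g gT N; have chR : R \char N := g0 _ _.
have sRN := char_sub chR; have nsRG := char_normal_trans chR nsNG.
have not_sNR : ~~ (N \subset R) by apply: contra neN => sNR; rewrite eqEsubset sNR sRN.
have sLR (L : {group gT}) : L <| G -> L \subset N -> L :!=: N -> L \subset R.
  move=> nsLG sLN neLN; have [eqL|neL] := eqVneq (gval (g gT L)) (gval L).
    by rewrite -eqL g2 // (normalS sLN (normal_sub nsNG)).
  by case/eqP: neLN; apply: minN => //; rewrite /P nsLG.
(* If [N] were not inside [C], then [N = A * (C :&: N)] would be a product of two subgroups of
   [R]. *)
have [k sRZ] : exists k, R \subset 'Z_k(N).
  apply: (sub_ucn sRN nsRG) => A nsAG sAR ntA.
  have [B [C [nsBG ltBA nsCG defG cAC]]] := quasinilpotent_chief qG nsAG ntA.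
  exists B; split=> //; apply: subset_trans cAC; rewrite commgS //.
  apply/idPn => not_sNC; case/negP: not_sNR.
  have sAN := subset_trans sAR sRN.
  have defN : A * (C :&: N) = N.
    rewrite group_modl //; apply/setIidPr.
    exact: subset_trans (normal_sub nsNG) defG.
  rewrite -{1}defN mul_subG //; apply: (sLR (C :&: N)%G); rewrite ?normalI ?subsetIr //.
  by apply: contra not_sNC => /eqP<-; apply: subsetIl.
have chN' : N^`(1) \char N := der_char 1 N.
have [perfN | neN'] := eqVneq (N^`(1)) N.
  case/negP: not_sNR; apply: subset_trans (g3 _ N); rewrite subsetI subxx centsC /=.
  exact: subset_trans sRZ (subset_trans (perfect_ucn k perfN) (subsetIr _ _)).
have sN'R := sLR _ (char_normal_trans chN' nsNG) (char_sub chN') neN'.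
case/eqP: neN; apply: functorial_nilpotent => //; apply/ucnP; exists k.+1.
apply/eqP; rewrite eqEsubset ucn_sub ucnSnR; apply/subsetP=> x Nx.
rewrite inE Nx /= (subset_trans _ (subset_trans sN'R sRZ)) //.
by rewrite commSg // sub1set.
Qed.

(** F3 and F4 are traded for the bounds [Fstar] and [Ftilde], the form in which F-functorials are
    recognised below. *)
Lemma FfunctorialP (g : fmap) :
  Ffunctorial g <-> [/\ F1 g, F2 g, fle Fstar g & fle g Ftilde].
Proof.
split=> [[fg g1 g2 g3 g4] | [g1 g2 leg geg]].
  split=> // gT G; last first.
    rewrite -sub_quotient_pre ?g4 // (subset_trans (char_sub (fg.1 _ _))) //.
    exact: normal_norm (Phi_normal G).
  have qF := Fstar_quasinilpotent G.
  rewrite -(functorial_quasinilpotent fg g2 g3 qF (normal_refl _)).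
  exact: g2 (Fstar_normal G).
have sg gT (G : {group gT}) : g gT G \subset G := subset_trans (geg _ _) (Ftilde_sub G).
split=> // [|gT G|gT G]; first exact: F1_functorial.
  apply: subset_trans (leg _ _); apply: subset_trans (Fstar_F3 G).
  exact/setIS/centS/leg.
rewrite sub_quotient_pre; first exact: geg.
exact: subset_trans (sg _ _) (normal_norm (Phi_normal G)).
Qed.

(** * The lattice of F-functorials *)

Lemma pbP (P : Prop) : reflect P (pb P).
Proof. by rewrite /pb; case: ClassicalEpsilon.excluded_middle_informative => ?; constructor. Qed.

(** For a Sylow subgroup [P] of [A], ['Phi(G) <*> P] is the preimage of a p-core, hence normal. The
    Frattini argument gives [G = 'Phi(G) * 'N_G(P)], so [P] itself is normal in [G]. *)
Lemma Frattini_nilpotent_sub_Fstar (gT : finGroupType) (G A : {group gT}) :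
  A <| G -> 'Phi(G) \subset A -> nilpotent (A / 'Phi(G)) -> A \subset Fstar gT G.
Proof.
move=> nsAG sPhiA nilA; have [sAG nAG] := andP nsAG; have nsPhi := Phi_normal G.
rewrite -[gval A]Sylow_gen gen_subG; apply/bigcupsP=> P /SylowP[p p_pr sylP].
have sPA := pHall_sub sylP; have nPhiP := subset_trans (subset_trans sPA sAG) (normal_norm nsPhi).
have nsPPhi : 'Phi(G) <*> P <| G.
  rewrite -(quotientYK nPhiP) -[X in _ <| X](quotientGK nsPhi) cosetpre_normal.
  rewrite (nilpotent_Hall_pcore (G := (A / 'Phi(G))%G) nilA (quotient_pHall nPhiP sylP)).
  by apply: char_normal_trans (pcore_char _ _) _; apply: quotient_normal.
have sylP' : p.-Sylow('Phi(G) <*> P) P.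
  by apply: pHall_subl sylP; rewrite ?joing_subr // join_subG sPhiA.
have := Frattini_arg nsPPhi sylP'.
have sPN : P \subset 'N_G(P) by rewrite subsetI (subset_trans sPA) ?normG.
have nPhiN : 'N_G(P) \subset 'N('Phi(G)) by rewrite subIset // normal_norm.
rewrite /= norm_joinEr // -mulgA (mulSGid sPN) -norm_joinEr //.
move/Phi_nongen; rewrite genGid => /setIidPl nPG.
apply: Fstar_max; first by rewrite /normal (subset_trans sPA).
exact: nilpotent_quasinilpotent (pgroup_nil (pHall_pgroup sylP)).
Qed.

Lemma Phi_sub_Fstar (gT : finGroupType) (G : {group gT}) : 'Phi(G) \subset Fstar gT G.
Proof.
apply: (@Frattini_nilpotent_sub_Fstar _ G [group of 'Phi(G)]) => //.
  exact: Phi_normal.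
by rewrite /= trivg_quotient nilpotent1.
Qed.

(** A minimal normal subgroup of [G / 'Phi(G)] inside the image of [M] lies in the derived subgroup
    of that image, or is abelian and has its preimage in [Fstar gT G]. *)
Lemma perfect_mod_Fstar (gT : finGroupType) (G M : {group gT}) :
  M <| G -> M \subset Ftilde gT G -> M \subset M^`(1) <*> Fstar gT G.
Proof.
move=> nsMG sMF; have nsPhi := Phi_normal G; have nPhiG := normal_norm nsPhi.
have [sMG nMG] := andP nsMG; have nPhiM := subset_trans sMG nPhiG.
have sFG := Fstar_sub G; have sPF := Phi_sub_Fstar G.
have nPhi_Q : M^`(1) <*> Fstar gT G \subset 'N('Phi(G)).
  by rewrite join_subG !(subset_trans _ nPhiG) // (subset_trans (der_sub 1 M)).
rewrite -(quotientSGK nPhiM (subset_trans sPF (joing_subr _ _))).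
have sMS : M / 'Phi(G) \subset Soc _ (G / 'Phi(G))%G by rewrite sub_quotient_pre.
have nsMb := quotient_normal 'Phi(G) nsMG.
have socM := @normal_sub_socle _ _ _ (M / 'Phi(G))%G (Soc_sub _) (Soc_socle _) nsMb sMS.
apply: subset_trans socM _; apply: (@socle_subP _ _ _ ((M^`(1) <*> Fstar gT G) / 'Phi(G))%G).
move=> A sAM minA; have nAG := minnormal_norm minA.
have sM'Q : (M / 'Phi(G))^`(1) \subset (M^`(1) <*> Fstar gT G) / 'Phi(G).
  by rewrite -quotient_der // quotientS ?joing_subl.
have [sAM' | tiAM'] := @minnormal_subVTI _ _ A (M / 'Phi(G))^`(1)%G minA
  (char_norm_trans (der_char 1 _) (normal_norm nsMb)).
  exact: subset_trans sAM' sM'Q.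
have abA : abelian A.
  apply/derG1P/trivgP; rewrite -tiAM' subsetI der_sub /=.
  exact: dergS.
have nsAG : A <| (G / 'Phi(G))%G by rewrite /normal nAG (subset_trans sAM) ?quotientS.
have [B defA sPhiB nsBG] := inv_quotientN nsPhi nsAG.
rewrite defA quotientS // (subset_trans _ (joing_subr _ _)) //.
by apply: Frattini_nilpotent_sub_Fstar; rewrite // -[_ / _]defA abelian_nil.
Qed.

(** Modulo [Fstar gT G], the group [U :&: V] is covered by its derived subgroup, which lies in
    [[~: U, V]]. *)
Lemma setI_sub_comm (gT : finGroupType) (G U V Q : {group gT}) :
    U <| G -> V <| G -> U \subset Ftilde gT G -> Fstar gT G \subset Q ->
    [~: U, V] \subset Q ->
  U :&: V \subset Q.
Proof.
move=> nsUG nsVG sUF sFQ sUVQ.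
have := @perfect_mod_Fstar _ G (U :&: V)%G (normalI nsUG nsVG).
move/(_ (subset_trans (subsetIl _ _) sUF))/subset_trans; apply.
rewrite join_subG sFQ andbT derg1; apply: subset_trans sUVQ.
by rewrite commgSS ?subsetIl ?subsetIr.
Qed.

Definition fbigmeet (I : Type) (g : I -> fmap) : fmap := fun gT G =>
  << [set x | pb (forall i, x \in g i gT G)] >>%G.

Definition fbigjoin (I : Type) (g : I -> fmap) : fmap := fun gT G =>
  << [set x | pb (exists i, x \in g i gT G)] >>%G.

Lemma fbigmeetE (I : Type) (g : I -> fmap) (gT : finGroupType) (G : {group gT}) :
  fbigmeet g G :=: [set x | pb (forall i, x \in g i gT G)].
Proof.
apply: gen_set_id; apply/group_setP; split=> [|x y].
  by rewrite inE; apply/pbP=> i.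
rewrite !inE => /pbP gx /pbP gy; apply/pbP=> i; exact: groupM.
Qed.

Lemma fbigmeetP (I : Type) (g : I -> fmap) (gT : finGroupType) (G : {group gT}) (x : gT) :
  reflect (forall i, x \in g i gT G) (x \in fbigmeet g G).
Proof. by have /setP-> := fbigmeetE g G; rewrite inE; apply: pbP. Qed.

Lemma fbigjoin_sub (I : Type) (g : I -> fmap) (gT : finGroupType) (G H : {group gT}) :
  reflect (forall i, g i gT G \subset H) (fbigjoin g G \subset H).
Proof.
rewrite gen_subG; apply: (iffP subsetP) => [sH i|sH x]; last first.
  by rewrite inE => /pbP[i]; apply: subsetP.
by apply/subsetP=> x gx; apply: sH; rewrite inE; apply/pbP; exists i.
Qed.

Lemma sub_fbigjoin (I : Type) (g : I -> fmap) i (gT : finGroupType) (G : {group gT}) :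
  g i gT G \subset fbigjoin g G.
Proof. exact/fbigjoin_sub. Qed.

Lemma fbigmeet_Ffunctorial (I : Type) (g : I -> fmap) :
  inhabited I -> (forall i, Ffunctorial (g i)) -> Ffunctorial (fbigmeet g).
Proof.
case=> i0 Fg; have {}Fg i := (FfunctorialP (g i)).1 (Fg i).
apply/FfunctorialP; split.
- move=> aT rT G f; apply/subsetP=> _ /morphimP[x Gx /fbigmeetP gx ->].
  apply/fbigmeetP=> i; have [g1 _ _ _] := Fg i.
  by apply: (subsetP (g1 _ _ _ f)); apply: mem_morphim.
- move=> gT G N nsNG; apply/subsetP=> x /fbigmeetP gx; apply/fbigmeetP=> i.
  by have [_ g2 _ _] := Fg i; apply: (subsetP (g2 _ _ _ nsNG)).
- move=> gT G; apply/subsetP=> x Fx; apply/fbigmeetP=> i.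
  by have [_ _ leg _] := Fg i; apply: (subsetP (leg _ _)).
(* The index [i0] provides the upper bound; an empty intersection would be the whole type. *)
move=> gT G; apply/subsetP=> x /fbigmeetP gx.
by have [_ _ _ geg] := Fg i0; apply: (subsetP (geg _ _)).
Qed.

Lemma fbigjoin_Ffunctorial (I : Type) (g : I -> fmap) :
  inhabited I -> (forall i, Ffunctorial (g i)) -> Ffunctorial (fbigjoin g).
Proof.
case=> i0 Fg; have {}Fg i := (FfunctorialP (g i)).1 (Fg i).
have sg i gT (G : {group gT}) : g i gT G \subset G.
  by have [_ _ _ geg] := Fg i; apply: subset_trans (geg _ _) (Ftilde_sub G).
apply/FfunctorialP; split.
- move=> aT rT G f; rewrite sub_morphim_pre; last exact/fbigjoin_sub.
  apply/(fbigjoin_sub _ _ (f @*^-1 fbigjoin g (f @* G))%G) => i.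
  rewrite /= -sub_morphim_pre ?sg //; apply: subset_trans (sub_fbigjoin _ i _).
  by have [g1 _ _ _] := Fg i; apply: g1.
- move=> gT G N nsNG; apply/fbigjoin_sub => i.
  by have [_ g2 _ _] := Fg i; apply: subset_trans (g2 _ _ _ nsNG) (sub_fbigjoin _ i _).
- move=> gT G; have [_ _ leg _] := Fg i0.
  exact: subset_trans (leg _ _) (sub_fbigjoin _ i0 _).
by move=> gT G; apply/fbigjoin_sub => i; have [_ _ _ geg] := Fg i; apply: geg.
Qed.

Lemma Ffunctorial_normal (g : fmap) gT (G : {group gT}) : Ffunctorial g -> g gT G <| G.
Proof. by case=> [[chg _] _ _ _ _]; apply/char_normal/chg. Qed.

Lemma commg_joing_sub (gT : finGroupType) (A B C Q : {group gT}) :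
    A \subset 'N(Q) -> B \subset 'N(Q) -> C \subset 'N(Q) ->
    [~: A, B] \subset Q -> [~: A, C] \subset Q ->
  [~: A, B <*> C] \subset Q.
Proof.
move=> nQA nQB nQC sAB sAC.
rewrite commGC -quotient_cents2 ?join_subG ?nQB // quotientY // join_subG.
by rewrite !quotient_cents2 // commGC sAB commGC.
Qed.

Lemma fmeet_joinr (g d e : fmap) :
    Ffunctorial g -> Ffunctorial d -> Ffunctorial e ->
  feq (fmeet g (fjoin d e)) (fjoin (fmeet g d) (fmeet g e)).
Proof.
move=> Fg Fd Fe gT G; have [_ _ leg geg] := (FfunctorialP g).1 Fg.
have [_ _ led _] := (FfunctorialP d).1 Fd.
have [nsA nsB nsC] :=
  And3 (Ffunctorial_normal G Fg) (Ffunctorial_normal G Fd) (Ffunctorial_normal G Fe).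
apply/eqP; rewrite /= eqEsubset andbC join_subG !setIS ?joing_subl ?joing_subr //=.
set Q := (X in _ \subset pred_of_set X).
have nsQ : Q <| G by rewrite normalY // normalI.
have sBCG : d gT G <*> e gT G <| G by rewrite normalY.
(* With [A], [B], [C] the values of [g], [d], [e], both [[~: A, B]] and [[~: A, C]] lie in [Q],
   hence so does [[~: A, B <*> C]]. *)
apply: (@setI_sub_comm _ G (g gT G) (d gT G <*> e gT G)%G Q%G nsA sBCG (geg _ _)).
  apply: subset_trans (joing_subl _ _); rewrite subsetI.
  by apply/andP; split; [apply: leg | apply: led].
have nQ (X : {group gT}) : X <| G -> X \subset 'N(Q).
  by move/normal_sub => sXG; apply: subset_trans sXG (normal_norm nsQ).
apply: (@commg_joing_sub _ _ _ _ Q%G); rewrite ?nQ //.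
  apply: subset_trans (joing_subl _ _); apply: commg_subI; rewrite subsetI.
    by rewrite subxx (subset_trans (normal_sub nsA)) // normal_norm.
  by rewrite subxx (subset_trans (normal_sub nsB)) // normal_norm.
apply: subset_trans (joing_subr _ _); apply: commg_subI; rewrite subsetI.
  by rewrite subxx (subset_trans (normal_sub nsA)) // normal_norm.
by rewrite subxx (subset_trans (normal_sub nsC)) // normal_norm.
Qed.

Lemma fjoin_meetr (g d e : fmap) :
    Ffunctorial g -> Ffunctorial d -> Ffunctorial e ->
  feq (fjoin g (fmeet d e)) (fmeet (fjoin g d) (fjoin g e)).
Proof.
move=> Fg Fd Fe gT G; have [_ _ leg geg] := (FfunctorialP g).1 Fg.
have [_ _ _ ged] := (FfunctorialP d).1 Fd.
have [nsA nsB nsC] :=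
  And3 (Ffunctorial_normal G Fg) (Ffunctorial_normal G Fd) (Ffunctorial_normal G Fe).
apply/eqP; rewrite /= eqEsubset join_subG !subsetI !joing_subl /=.
rewrite (subset_trans (subsetIl _ _) (joing_subr _ _)).
rewrite (subset_trans (subsetIr _ _) (joing_subr _ _)) /=.
set Q := (X in _ \subset pred_of_set X).
have nsQ : Q <| G by rewrite normalY // normalI.
have nQ (X : {group gT}) : X <| G -> X \subset 'N(Q).
  by move/normal_sub => sXG; apply: subset_trans sXG (normal_norm nsQ).
have [nQA nQB nQC] := And3 (nQ _ nsA) (nQ _ nsB) (nQ _ nsC).
have sAQ : g gT G \subset Q := joing_subl _ _.
apply: (@setI_sub_comm _ G (g gT G <*> d gT G)%G (g gT G <*> e gT G)%G Q%G).
- exact: normalY.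
- exact: normalY.
- by rewrite join_subG; apply/andP; split; [apply: geg | apply: ged].
- exact: subset_trans (leg _ _) sAQ.
(* Modulo [Q] the subgroup [A] vanishes, so only [[~: B, C] \subset B :&: C] is needed. *)
rewrite -quotient_cents2 ?join_subG ?nQA //= !quotientY // !(quotientS1 sAQ) !joing1G.
rewrite quotient_cents2 // (subset_trans _ (joing_subr _ _)) //.
apply: commg_subI; rewrite subsetI subxx.
  by rewrite (subset_trans (normal_sub nsB)) // normal_norm.
by rewrite (subset_trans (normal_sub nsC)) // normal_norm.
Qed.

(** * Lower and upper products *)

Lemma Ffunctorial_sub (g : fmap) (gT : finGroupType) (G : {group gT}) :
  Ffunctorial g -> g gT G \subset G.
Proof. by move/(Ffunctorial_normal G)/normal_sub. Qed.

Lemma Fstar_Ffunctorial : Ffunctorial Fstar.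
Proof.
by apply/FfunctorialP; split; [apply: Fstar_F1 | apply: Fstar_F2 | | apply: Fstar_le_Ftilde].
Qed.

Lemma Ftilde_Ffunctorial : Ffunctorial Ftilde.
Proof.
by apply/FfunctorialP; split; [apply: Ftilde_F1 | apply: Ftilde_F2 | apply: Fstar_le_Ftilde | ].
Qed.

Lemma fcomp_Fstarl (g : fmap) : Ffunctorial g -> feq (fcomp Fstar g) Fstar.
Proof.
move=> [fg _ g2 g3 _] gT G.
exact: (functorial_quasinilpotent fg g2 g3 (Fstar_quasinilpotent G) (normal_refl _)).
Qed.

Lemma fcomp_Fstarr (g : fmap) : Ffunctorial g -> feq (fcomp g Fstar) Fstar.
Proof.
move=> Fg gT G; have [_ _ leg _] := (FfunctorialP g).1 Fg.
apply/eqP; rewrite eqEsubset /fcomp (Fstar_F2 (Ffunctorial_normal G Fg)) /=.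
apply: Fstar_max (Fstar_quasinilpotent G).
exact: normalS (leg _ _) (Ffunctorial_sub G Fg) (Fstar_normal G).
Qed.

(** F1 and F2 for [g] give normal inclusions between values of [g], to which F2 for [d] applies; the
    lower bound uses that [g] does not change [Fstar]. *)
Lemma fcomp_Ffunctorial (g d : fmap) :
  Ffunctorial g -> Ffunctorial d -> Ffunctorial (fcomp g d).
Proof.
move=> Fg Fd; have [chg _] : functorial g by case: Fg.
have [g1 g2 leg geg] := (FfunctorialP g).1 Fg.
have [d1 d2 led _] := (FfunctorialP d).1 Fd.
have sd gT (G : {group gT}) : d gT G \subset G := Ffunctorial_sub G Fd.
apply/FfunctorialP; rewrite /fcomp; split.
- move=> aT rT G f; have sgG := Ffunctorial_sub G Fg.
  apply: subset_trans (F1_sub f d1 sd sgG) _; apply: d2.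
  apply: normalS (g1 _ _ _ f) (Ffunctorial_sub _ Fg) _.
  exact: morphim_normal (Ffunctorial_normal G Fg).
- move=> gT G N nsNG; apply: d2.
  apply: normalS (g2 _ _ _ nsNG) (Ffunctorial_sub G Fg) _.
  exact: char_normal_trans (chg _ N) nsNG.
- move=> gT G; rewrite -(fcomp_Fstarr Fg) /fcomp; exact: led.
by move=> gT G; apply: subset_trans (sd _ _) (geg _ _).
Qed.

Lemma fpow_Ffunctorial (g : fmap) n : Ffunctorial g -> Ffunctorial (fpow n g).
Proof. by move=> Fg; elim: n => // n IHn; apply: (fcomp_Ffunctorial IHn Fg). Qed.

Lemma finf_Ffunctorial (g : fmap) : Ffunctorial g -> Ffunctorial (finf g).
Proof.
move=> Fg; apply: (@fbigmeet_Ffunctorial nat (fun n => fpow n g)) => [|n].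
  exact: (inhabits 0).
exact: fpow_Ffunctorial.
Qed.

Lemma finfP (g : fmap) (gT : finGroupType) (G : {group gT}) (x : gT) :
  reflect (forall n, x \in fpow n g gT G) (x \in finf g gT G).
Proof. exact: (fbigmeetP (fun n => fpow n g)). Qed.

Lemma finf_stable (g : fmap) (gT : finGroupType) (G : {group gT}) :
  Ffunctorial g -> g gT (finf g gT G) :=: finf g gT G.
Proof.
move=> Fg; have sg (H : {group gT}) : g gT H \subset H := Ffunctorial_sub H Fg.
have [n fix_n] : exists n, g gT (fpow n g gT G) = fpow n g gT G.
  (* Until the chain of iterates stabilises, every step lowers the order, which cannot happen more
     than [#|G|] times. *)
  suffices dec m : (exists n, g gT (fpow n g gT G) = fpow n g gT G)
                   \/ #|fpow m g gT G| + m <= #|G|.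
    have [//|] := dec #|G|.+1.
    by rewrite addnS ltnNge leq_addl.
  elim: m => [|m [fixn|IHm]]; [right | by left |].
    by rewrite addn0 subset_leq_card.
  have [eqm | neqm] := eqVneq (gval (g gT (fpow m g gT G))) (gval (fpow m g gT G)).
    by left; exists m; apply: group_inj.
  right; apply: leq_trans IHm; rewrite addnS ltn_add2r proper_card //.
  by rewrite properEneq neqm sg.
suffices eq_inf : finf g gT G = fpow n g gT G by rewrite eq_inf fix_n.
apply/group_inj/eqP; rewrite eqEsubset; apply/andP; split.
  by apply/subsetP=> x /finfP.
have fix_nk k : fpow (n + k) g gT G = fpow n g gT G.
  by elim: k => [|k IHk]; rewrite ?addn0 // addnS /= IHk.
apply/subsetP=> x xn; apply/finfP=> k; rewrite -(fix_nk k) in xn.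
elim: n xn {fix_n fix_nk} => [//|n IHn]; rewrite addSn => xn.
by apply: IHn; apply: (subsetP (sg _)).
Qed.

Lemma finf_idempotent (g : fmap) : Ffunctorial g -> fidempotent (finf g).
Proof.
move=> Fg gT G; have fixG : g gT (finf g gT G) = finf g gT G.
  exact/group_inj/finf_stable.
have fixn n : fpow n g gT (finf g gT G) = finf g gT G.
  by elim: n => //= n ->.
apply/setP=> x; rewrite /fcomp; apply/finfP/idP => [/(_ 0) | xg n].
  by rewrite fixn.
by rewrite fixn.
Qed.

(** Inductively [g G = g (g G)] lies in [d (g G)], and F2 for [d] carries this to the next iterate
    because [g G] is normal in the current one. *)
Lemma fidempotent_le_finf (g d : fmap) :
  Ffunctorial g -> Ffunctorial d -> fidempotent g -> fle g d -> fle g (finf d).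
Proof.
move=> Fg Fd idg led gT G; have [_ d2 _ _] := (FfunctorialP d).1 Fd.
suffices sub_n n : g gT G \subset fpow n d gT G.
  by apply/subsetP=> x gx; apply/finfP=> n; apply: (subsetP (sub_n n)).
elim: n => [|n IHn]; first exact: led.
rewrite -(idg gT G) /=; apply: subset_trans (led _ _) (d2 _ _ _ _).
apply: normalS IHn _ (Ffunctorial_normal G Fg).
exact: Ffunctorial_sub G (fpow_Ffunctorial n Fd).
Qed.

Lemma Ftilde_Phi1 (gT : finGroupType) (G : {group gT}) :
  'Phi(G) = 1 -> Ftilde gT G \subset Soc gT G.
Proof.
move=> Phi1; have idG : (idm_morphism G @* G)%G = G by apply: group_inj; rewrite /= morphim_idm.
have := @F1_quotient Soc _ _ _ G [group of 'Phi(G)] (idm_morphism G)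
  Soc_F1 Soc_sub (subxx _) (Phi_normal _).
rewrite idG morphim_idm ?Phi_sub // morphim_idm; last exact: Ftilde_sub.
exact.
Qed.

Lemma Frattini_functorial_normal (p : fmap) (gT : finGroupType) (G : {group gT}) :
  Frattini_functorial p -> p gT G <| G.
Proof. by case=> [[chp _] _ _ _]; apply/char_normal/chp. Qed.

(** One inclusion passes from [G / p G] to the Frattini-free quotient [G / 'Phi(G)]; the other is F1
    along [G -> G / p G]. *)
Lemma fstar_Ftilde (p : fmap) : Frattini_functorial p -> feq (fstar p Ftilde) Ftilde.
Proof.
move=> Fp gT G; have [_ p1 _ pPhi] := Fp.
have nsp gT' (H : {group gT'}) := Frattini_functorial_normal H Fp.
have nsPhi := Phi_normal G.
have sF gT' (H : {group gT'}) : Ftilde gT' H \subset H := Ftilde_sub H.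
apply/eqP; rewrite eqEsubset; apply/andP; split.
  have := @F2_lift Ftilde gT G G (p gT G) [group of 'Phi(G)] Ftilde_F1 sF
    (normal_refl G) (nsp _ G) nsPhi (pPhi _ _) (subxx _).
  move/subset_trans; apply; apply: morphpreS; apply: Ftilde_Phi1.
  exact: Phi_quotient_id.
rewrite -sub_quotient_pre.
  exact: (F1_sub (coset_morphism _) Ftilde_F1 sF (normal_norm (nsp _ G))).
exact: subset_trans (Ftilde_sub G) (normal_norm (nsp _ G)).
Qed.

Lemma fstar_Ffunctorial (p g : fmap) :
  Frattini_functorial p -> Ffunctorial g -> Ffunctorial (fstar p g).
Proof.
move=> Fp Fg; have [_ p1 p2 pPhi] := Fp.
have nsp gT (G : {group gT}) := Frattini_functorial_normal G Fp.
have [g1 g2 leg geg] := (FfunctorialP g).1 Fg.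
have sg gT (G : {group gT}) : g gT G \subset G := Ffunctorial_sub G Fg.
have npG gT (G : {group gT}) := normal_norm (nsp _ G).
apply/FfunctorialP; split.
- by move=> aT rT G f; apply: F1_lift.
- move=> gT G N nsNG; apply: F2_lift => //; first exact: p2.
  exact/g2/quotient_normal.
- move=> gT G; rewrite -sub_quotient_pre; last exact: subset_trans (Fstar_sub G) (npG _ _).
  apply: subset_trans (leg _ _).
  exact: (F1_sub (coset_morphism _) Fstar_F1 Fstar_sub (npG _ G)).
move=> gT G; rewrite -(fstar_Ftilde Fp); apply: morphpreS; exact: geg.
Qed.

(** * Frattini extensions of alternating groups by modules of flows *)

Import GRing.Theory.

Definition flow (p : nat) : Type := ({ffun 'F_p * 'F_p -> 'F_p} * {perm 'F_p})%type.

HB.instance Definition _ (p : nat) := Finite.on (flow p).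

Section Flow.
Variable p : nat.
Implicit Types a b : flow p.

(* The semidirect product of flows by permutations, the latter acting by pullback. *)
Definition flow_mul a b : flow p :=
  ([ffun e => a.1 e + b.1 (a.2 e.1, a.2 e.2)]%R, a.2 * b.2).
Definition flow_one : flow p := ([ffun => 0%R], 1).
Definition flow_inv a : flow p :=
  ([ffun e => - a.1 ((a.2^-1)%g e.1, (a.2^-1)%g e.2)]%R, a.2^-1).

Fact flow_mulA : associative flow_mul.
Proof.
move=> a b c; congr (_, _); last exact: mulgA.
by apply/ffunP=> e; rewrite !ffunE !permM addrA.
Qed.

Fact flow_mul1 : left_id flow_one flow_mul.
Proof.
case=> m s; congr (_, _); last exact: mul1g.
by apply/ffunP=> -[x y]; rewrite !ffunE !perm1 add0r.
Qed.

Fact flow_mulV : left_inverse flow_one flow_inv flow_mul.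
Proof.
move=> a; congr (_, _); last exact: mulVg.
by apply/ffunP=> e; rewrite !ffunE addNr.
Qed.

HB.instance Definition _ := Finite_isGroup.Build (flow p) flow_mulA flow_mul1 flow_mulV.

Lemma flow_mul1E a b e : ((a * b)%g.1 e = a.1 e + b.1 (a.2 e.1, a.2 e.2))%R.
Proof. by rewrite ffunE. Qed.

Lemma flow_mul2E a b : (a * b).2 = a.2 * b.2.
Proof. by []. Qed.

Definition flow_perm a : {perm 'F_p} := a.2.

Fact flow_permM : {in [set: flow p] &, {morph flow_perm : a b / a * b}}.
Proof. by []. Qed.
Canonical flow_perm_morphism := Morphism flow_permM.

(** The entries of a power are sums along orbits of the permutation on edges. *)
Lemma flow_expE a n e :
  ((a ^+ n)%g.1 e = \sum_(j < n) a.1 ((a.2 ^+ j)%g e.1, (a.2 ^+ j)%g e.2))%R.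
Proof.
elim: n e => [|n IHn] e; first by rewrite big_ord0 ffunE.
rewrite expgS flow_mul1E IHn big_ord_recl !perm1 -surjective_pairing; congr (_ + _)%R.
by apply: eq_bigr => j _; rewrite /= expgS !permM.
Qed.

(** The net inflow at the vertex [v]. *)
Definition boundary (m : {ffun 'F_p * 'F_p -> 'F_p}) (v : 'F_p) : 'F_p :=
  (\sum_u (m (u, v) - m (v, u)))%R.

(** The prescribed boundary, [s^-1(0)] minus [0], is a cocycle in the permutation [s]; hence closure
    under products. *)
Definition flows : {set flow p} :=
  [set a : flow p | [forall v, boundary a.1 v == (a.2 v == 0)%:R - (v == 0)%:R]%R].

Lemma flowsP a :
  reflect (forall v, boundary a.1 v = (a.2 v == 0)%:R - (v == 0)%:R)%R (a \in flows).
Proof. by rewrite inE; apply: (iffP forallP) => + v => /(_ v)/eqP. Qed.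

Fact flows_group_set : group_set flows.
Proof.
apply/group_setP; split=> [|a b /flowsP Ea /flowsP Eb]; apply/flowsP=> v.
  by rewrite perm1 subrr /boundary big1 // => u _; rewrite !ffunE subrr.
have -> : ((((a * b)%g.2 v == 0)%:R - (v == 0)%:R = ((a.2 v == 0)%:R - (v == 0)%:R)
    + ((b.2 (a.2 v) == 0)%:R - (a.2 v == 0)%:R) :> 'F_p))%R.
  by rewrite permM [RHS]addrC addrA subrK.
rewrite -Ea -Eb /boundary.
rewrite [X in (_ + X)%R](reindex_inj (@perm_inj _ a.2)) -big_split /=.
by apply: eq_bigr => u _; rewrite !ffunE /= opprD addrACA.
Qed.
Canonical flows_group := Group flows_group_set.

Lemma flows_onto : flow_perm @* flows = [set: {perm 'F_p}].
Proof.
apply/eqP; rewrite eqEsubset subsetT; apply/subsetP=> s _.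
(* One unit along the edge from [0] to [s^-1(0)], a loop when [s] fixes [0]. *)
pose m : {ffun 'F_p * 'F_p -> 'F_p} := [ffun e : 'F_p * 'F_p => ((e.1 == 0) && (s e.2 == 0))%:R]%R.
suffices Ems : (m, s) \in flows by apply/morphimP; exists (m, s) => //; apply: in_setT.
apply/flowsP=> v; rewrite /boundary sumrB /=; congr (_ - _)%R.
  rewrite (bigD1 (0%R : 'F_p)) //= big1 => [|u /negPf nu]; rewrite ffunE /= ?nu //.
  by rewrite ?eqxx addr0.
rewrite (bigD1 (s^-1 0%R)) //= big1 => [|u nu]; rewrite ffunE /=.
  by rewrite permKV eqxx andbT addr0.
case: eqP => //= _; case: eqP => // su; case/eqP: nu.
by rewrite -su permK.
Qed.

Definition shift : {perm 'F_p} := perm (@addrI 'F_p 1%R).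

Lemma shiftX n x : ((shift ^+ n)%g x = x + n%:R)%R.
Proof.
elim: n x => [|n IHn] x; first by rewrite perm1 addr0.
by rewrite expgS permM IHn permE -natr1 [(1 + x)%R]addrC -addrA [(1 + _)%R]addrC.
Qed.

Hypothesis p_pr : prime p.

Lemma sum_Fp (F : 'F_p -> 'F_p) : (\sum_(j < p) F j%:R = \sum_x F x)%R.
Proof.
have injn : injective (fun j : 'I_p => j%:R : 'F_p)%R.
  move=> i j /(congr1 val); rewrite /= !val_Fp_nat // !modn_small //.
  exact: val_inj.
by rewrite [RHS](reindex _ (onW_bij _ (inj_card_bij injn _))) // card_Fp // card_ord.
Qed.

Lemma shift_flow_exp a : a \in flows -> a.2 = shift -> a ^+ p != 1.
Proof.
move=> /flowsP Ea a2; apply/eqP=> ap1.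
(* The pairing of a flow with the shift-invariant function (x, y) |-> y - x on
   edges is a combination of the sums of the flow over the orbits of the shift,
   which are the entries of a ^+ p; it is also the sum of v * boundary v, here -1. *)
have sum0 (d : 'F_p) : (\sum_(x : 'F_p) a.1 (x, x + d) = 0)%R.
  have := flow_expE a p (0, d)%R; rewrite ap1 ffunE a2 /= => sum0.
  rewrite [RHS]sum0 -(sum_Fp (fun x => a.1 (x, x + d))%R).
  by apply: eq_bigr => j _; rewrite !shiftX add0r addrC.
have: (\sum_(v : 'F_p) v * boundary a.1 v = 0)%R.
  transitivity (\sum_(x : 'F_p) \sum_(y : 'F_p) (y - x) * a.1 (x, y))%R; last first.
    transitivity (\sum_(x : 'F_p) \sum_(d : 'F_p) d * a.1 (x, x + d))%R.
      apply: eq_bigr => x _; rewrite (reindex_inj (addrI x)); apply: eq_bigr => d _.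
      by congr (_ * _)%R; rewrite addrC addKr.
    rewrite exchange_big big1 //= => d _; by rewrite -mulr_sumr sum0 mulr0.
  rewrite /boundary.
  under eq_bigr do rewrite mulr_sumr.
  under eq_bigr do under eq_bigr do rewrite mulrBr.
  under eq_bigr do rewrite sumrB.
  rewrite sumrB exchange_big /= -sumrB; apply: eq_bigr => x _.
  by rewrite -sumrB; apply: eq_bigr => y _; rewrite mulrBl.
under eq_bigr do rewrite Ea a2 permE mulrBr.
rewrite sumrB [X in (_ - X)%R]big1 => [|v _]; last first.
  by case: eqP => [->|]; rewrite ?mul0r ?mulr0.
rewrite (bigD1 (- 1 : 'F_p)%R) //= big1 => [|v nv]; last first.
  case: eqP => [v1|]; rewrite ?mulr0 //; case/eqP: nv.
  by apply/eqP; rewrite -addr_eq0 addrC; apply/eqP.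
by rewrite subrr eqxx mulr1 addr0 subr0 => /eqP; rewrite oppr_eq0 oner_eq0.
Qed.

End Flow.

(** * Minimal covers of simple groups *)

Lemma simple_Phi (gT : finGroupType) (S : {group gT}) :
  simple S -> 'Phi(S) = 1.
Proof.
move/simpleP=> [ntS maxS]; have [//|eqS] := maxS [group of 'Phi(S)] (Phi_normal S).
by have := Phi_proper ntS; rewrite /= in eqS; rewrite eqS properxx.
Qed.

Lemma simple_nonsolvable_perfect (gT : finGroupType) (S : {group gT}) :
  simple S -> ~~ solvable S -> S^`(1) = S.
Proof.
move/simpleP=> [_ maxS] nsolS.
have [|//] := maxS [group of S^`(1)] (der_normal 1 S).
by move/derG1P/abelian_sol => solS; rewrite solS in nsolS.
Qed.

Section MinimalCover.
Variables (aT rT : finGroupType) (D : {group aT}) (f : {morphism D >-> rT}).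
Implicit Types E K : {group aT}.

Lemma minimal_cover_exists E S :
  f @* E = S -> exists K : {group aT}, K \subset E /\ [min K of H | f @* H == S].
Proof.
move=> fE; have [|K minK sKE] := @mingroup_exists _ (fun H : {group aT} => f @* H == S) E.
  exact/eqP.
by exists K.
Qed.

Variables (K : {group aT}) (S : {group rT}).
Hypotheses (sKD : K \subset D) (minK : [min K of H | f @* H == S]).

Lemma minimal_cover_im : f @* K = S.
Proof. by apply/eqP; apply: mingroupp minK. Qed.

Lemma minimal_cover_eq (H : {group aT}) : H \subset K -> f @* H = S -> H :=: K.
Proof. by move=> sHK fH; case/mingroupP: minK => _; apply=> //; apply/eqP. Qed.

(** A maximal subgroup of [K] not containing the kernel would still map onto [S], against
    minimality. *)
Lemma minimal_cover_Phi : 'Phi(S) = 1 -> 'Phi(K) = 'ker_K f.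
Proof.
move=> PhiS; apply/eqP; rewrite eqEsubset; apply/andP; split.
  rewrite subsetI Phi_sub kerE -sub_morphim_pre ?(subset_trans (Phi_sub K)) //.
  rewrite -PhiS -minimal_cover_im.
  apply: (@F1_sub (fun gT G => [group of 'Phi(G)]) _ _ _ K f) => //.
    by move=> gT1 gT2 G h; apply: Frattini_continuous.
  by move=> gT G; apply: Phi_sub.
apply/bigcapsP=> M /predU1P[-> | maxM]; first exact: subsetIl.
apply/idPn => not_sWM; have sMK := proper_sub (maxgroupp maxM).
have nsW : 'ker_K f <| K.
  by rewrite /normal subsetIl normsI ?normG // (subset_trans sKD) ?ker_norm.
have defK := normal_maximal_mul nsW maxM not_sWM.
have eqMK : M :=: K.
  apply: minimal_cover_eq => //; rewrite -minimal_cover_im -[in RHS]defK.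
  rewrite morphimMl ?(subset_trans (subsetIl _ _)) //.
  rewrite (_ : f @* 'ker_K f = 1) ?mul1g //; apply/trivgP.
  by rewrite -(morphim_ker f) morphimS ?subsetIr.
by have := maxgroupp maxM; rewrite eqMK properxx.
Qed.

Lemma minimal_cover_quotient_isog : 'Phi(S) = 1 -> K / 'Phi(K) \isog S.
Proof.
by move=> PhiS; rewrite minimal_cover_Phi // -minimal_cover_im first_isog_loc.
Qed.

Lemma minimal_cover_perfect : S^`(1) = S -> K^`(1) = K.
Proof.
move=> perfS; apply: minimal_cover_eq (der_sub 1 K) _.
by rewrite /= morphim_der // minimal_cover_im.
Qed.

End MinimalCover.

(** For a chief factor [A / B] inside ['Phi(K)], [K = A * C] gives [C = K] by non-generation, so [K]
    centralises [A / B]. Thus ['Phi(K)] is hypercentral, and perfection makes it central. *)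
Lemma quasinilpotent_perfect_Phi_central (gT : finGroupType) (K : {group gT}) :
  quasinilpotent gT K -> K^`(1) = K -> 'Phi(K) \subset 'Z(K).
Proof.
move=> qK perfK; have [|k sPZ] := sub_ucn (Phi_sub K) (Phi_normal K).
  move=> A nsAK sAPhi ntA.
  have [B [C [nsBK ltBA nsCK defK cAC]]] := quasinilpotent_chief qK nsAK ntA.
  exists B; split=> //; suffices defC : K \subset C by apply: subset_trans cAC; rewrite commgS.
  have : 'Phi(K) <*> C = K.
    apply/eqP; rewrite eqEsubset join_subG Phi_sub normal_sub //=.
    rewrite norm_joinEr ?(subset_trans (normal_sub nsCK)) ?normal_norm ?Phi_normal //.
    by apply: subset_trans defK _; rewrite mulSg.
  by move/Phi_nongen; rewrite genGid => ->.
exact: subset_trans sPZ (perfect_ucn k perfK).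
Qed.

Lemma flow_ker_exp (p : nat) (a : flow p) : prime p -> a.2 = 1 -> a ^+ p = 1.
Proof.
move=> p_pr a2.
have ap2 : (a ^+ p).2 = 1.
  by rewrite -[LHS]/(flow_perm (a ^+ p)) (morphX (flow_perm_morphism p))
    ?inE //= /flow_perm a2 expg1n.
rewrite [LHS]surjective_pairing ap2; congr (_, _); apply/ffunP=> e.
rewrite flow_expE ffunE.
transitivity (\sum_(j < p) a.1 e)%R.
  by apply: eq_bigr => j _; rewrite a2 expg1n !perm1 -surjective_pairing.
by rewrite sumr_const card_ord mulrn_pchar // pchar_Fp.
Qed.

(** The shift is the square of the translation by one half. *)
Lemma shift_Alt (p : nat) : prime p -> 4 < p -> shift p \in 'Alt_('F_p).
Proof.
move=> p_pr p4; have nz2 : (2%:R != 0 :> 'F_p)%R.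
  by rewrite -(dvdn_pcharf (pchar_Fp p_pr)) gtnNdvd // (ltn_trans _ p4).
pose u : {perm 'F_p} := perm (addrI (2%:R^-1 : 'F_p)%R).
have half : (2%:R^-1 + 2%:R^-1 = 1 :> 'F_p)%R.
  by rewrite -[(_ + _)%R](mulr2n 2%:R^-1%R) -[LHS](mulr_natr 2%:R^-1%R) mulVf.
have -> : shift p = u * u.
  by apply/permP=> x; rewrite permM !permE addrA half.
by rewrite Alt_even odd_permM addbb.
Qed.

(** The conjugating element is multiplication by 4, even as the square of multiplication by 2. *)
Lemma shift_conj_Alt (p : nat) : prime p -> 4 < p ->
  exists2 t : {perm 'F_p}, t \in 'Alt_('F_p) & shift p ^ t = shift p ^+ 4.
Proof.
move=> p_pr p4; have nz2 : (2%:R != 0 :> 'F_p)%R.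
  by rewrite -(dvdn_pcharf (pchar_Fp p_pr)) gtnNdvd // (ltn_trans _ p4).
pose u : {perm 'F_p} := perm (mulfI nz2).
exists (u * u); first by rewrite Alt_even odd_permM addbb.
apply: (mulgI (u * u)); rewrite -conjgC; apply/permP=> x.
by rewrite [RHS]permM shiftX !permM !permE !mulrDr mulr1 -natrM addrC.
Qed.

Lemma flow_ext_exists (p : nat) : prime p -> 4 < p ->
  exists K : {group flow p}, [/\ simple (K / 'Phi(K)), #|K / 'Phi(K)| = #|'Alt_('F_p)|
    & ~~ quasinilpotent _ K].
Proof.
move=> p_pr p4; set S := 'Alt_('F_p)%G; pose f := flow_perm_morphism p.
have p2 : 1 < p by apply: prime_gt1.
have simS : simple S by rewrite simple_Alt5 // card_Fp.
have nsolS : ~~ solvable S by rewrite solvable_AltF // card_Fp.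
have fE : f @* (flows p :&: f @*^-1 S) = S.
  by rewrite morphim_setIpre flows_onto setTI.
have [K [sKE minK]] := minimal_cover_exists (E := (flows_group p :&: f @*^-1 S)%G) fE.
have sKF := subset_trans sKE (subsetIl _ _).
have sKD : K \subset [set: flow p] := subsetT _.
have PhiS := simple_Phi simS.
have isoK := minimal_cover_quotient_isog sKD minK PhiS.
have perfK := minimal_cover_perfect sKD minK (simple_nonsolvable_perfect simS nsolS).
exists K; split; [by rewrite (isog_simple isoK) | exact: card_isog isoK |].
apply/negP=> /quasinilpotent_perfect_Phi_central/(_ perfK).
rewrite (minimal_cover_Phi sKD minK PhiS) subsetI => /andP[_ cWK].
have fK := minimal_cover_im minK.
have lift s : s \in S -> exists2 g, g \in K & g.2 = s.
  by move=> Ss; have: s \in f @* K; [rewrite fK | case/morphimP=> g _ Kg ->; exists g].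
have [g Kg g2] := lift _ (shift_Alt p_pr p4).
have [t St ct] := shift_conj_Alt p_pr p4.
have [h Kh h2] := lift _ St.
have f2 (a : flow p) : f a = a.2 by [].
have inW (a : flow p) : a \in K -> a.2 = 1 -> a \in 'ker_K f.
  by move=> Ka a2; rewrite inE Ka; apply/kerP; rewrite ?inE.
have fX (a : flow p) n : (a ^+ n).2 = a.2 ^+ n by rewrite -!f2 morphX ?inE.
have fJ (a b : flow p) : (a ^ b).2 = a.2 ^ b.2 by rewrite -!f2 morphJ ?inE.
have fV (a : flow p) : (a^-1).2 = a.2^-1 by [].
(* [g ^ h] and [g ^+ 4] lie over the same permutation, so they differ by an element [w] of the
   kernel, which is central and of exponent dividing [p]. Taking [p]-th powers gives
   [g ^+ p = (g ^+ p) ^+ 4]. *)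
pose w := (g ^+ 4)^-1 * g ^ h.
have Kw : w \in K by rewrite groupM ?groupV ?groupX ?groupJ.
have w2 : w.2 = 1.
  by rewrite flow_mul2E fJ g2 h2 ct fV fX g2 mulVg.
have gp_neq1 := shift_flow_exp p_pr (subsetP sKF g Kg) g2.
have gp2 : (g ^+ p).2 = 1.
  rewrite fX g2; apply/permP=> x; rewrite shiftX perm1.
  by rewrite (pcharf0 (pchar_Fp p_pr)) addr0.
have Kgp : g ^+ p \in K by rewrite groupX.
have cW (a b : flow p) : a \in K -> a.2 = 1 -> b \in K -> commute a b.
  by move=> Ka a2 Kb; apply: (centP (subsetP cWK a (inW a Ka a2))).
have gpJ : (g ^+ p) ^ h = g ^+ p by apply/conjg_fixP/commgP/cW.
have gp4 : g ^+ p = (g ^+ p) ^+ 4.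
  rewrite -{1}gpJ conjXg -[g ^ h](mulKVg (g ^+ 4)) -/w.
  rewrite expgMn; last by apply/commute_sym/cW; rewrite ?groupX.
  by rewrite (flow_ker_exp p_pr w2) mulg1 -!expgM mulnC.
have gp3 : (g ^+ p) ^+ 3 = 1 by apply: (mulgI (g ^+ p)); rewrite -expgS -gp4 mulg1.
have gpp : (g ^+ p) ^+ p = 1 by apply: flow_ker_exp.
case/eqP: gp_neq1; apply/eqP; rewrite -order_eq1 -dvdn1.
have : #[g ^+ p] %| gcdn p 3 by rewrite dvdn_gcd !order_dvdn gpp gp3 eqxx.
have /eqP -> // : coprime p 3.
by rewrite coprime_sym prime_coprime // dvdn_prime2 // ltn_eqF // (ltn_trans _ p4).
Qed.

(** * Counting F-functorials *)

(** With subnormal rather than normal generators [M], F2 follows from transitivity. *)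
Definition head_radical (s : nat -> bool) : fmap := fun gT G =>
  << Fstar gT G :|: \bigcup_(M : {group gT} |
       [&& M <|<| G, simple (M / 'Phi(M)) & s #|M / 'Phi(M)|]) M >>%G.

Section HeadRadical.
Variable s : nat -> bool.

Lemma head_radical_subP (gT : finGroupType) (G H : {group gT}) :
  Fstar gT G \subset H ->
  (forall M : {group gT}, M <|<| G -> simple (M / 'Phi(M)) -> s #|M / 'Phi(M)| -> M \subset H) ->
  head_radical s G \subset H.
Proof.
move=> sFH sMH; rewrite gen_subG subUset sFH; apply/bigcupsP=> M /and3P[]; exact: sMH.
Qed.

Lemma Fstar_le_head_radical (gT : finGroupType) (G : {group gT}) :
  Fstar gT G \subset head_radical s G.
Proof. by rewrite sub_gen // subsetUl. Qed.

Lemma sub_head_radical (gT : finGroupType) (G M : {group gT}) :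
  M <|<| G -> simple (M / 'Phi(M)) -> s #|M / 'Phi(M)| -> M \subset head_radical s G.
Proof.
move=> snM simM sM; rewrite sub_gen // subsetU // orbC.
by rewrite (bigcup_sup M) // snM simM.
Qed.

(** Simplicity leaves two options for the kernel of [M -> f @* M / 'Phi(f @* M)]: it is ['Phi(M)] or
    [M], and the latter would put [f @* M] in its own Frattini subgroup. *)
Lemma morphim_simple_head (aT rT : finGroupType) (D M : {group aT}) (f : {morphism D >-> rT}) :
    M \subset D -> simple (M / 'Phi(M)) -> f @* M != 1 ->
  M / 'Phi(M) \isog (f @* M) / 'Phi(f @* M).
Proof.
move=> sMD simM ntfM; pose N := (f @* M)%G.
have nPN : N \subset 'N('Phi(N)) := normal_norm (Phi_normal N).
pose h := [morphism of coset 'Phi(N) \o f].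
have sME : M \subset f @*^-1 'N('Phi(N)) by rewrite -sub_morphim_pre.
have ker_h : 'ker_M h = 'Phi(M).
  have sPk : 'Phi(M) \subset 'ker_M h.
    rewrite subsetI Phi_sub /= ker_comp ker_coset.
    rewrite -sub_morphim_pre ?(subset_trans (Phi_sub M)) //.
    apply: (@F1_sub (fun gT G => [group of 'Phi(G)]) _ _ _ M f) => //.
      by move=> gT1 gT2 G k; apply: Frattini_continuous.
    by move=> gT G; apply: Phi_sub.
  have nskM : 'ker_M h <| M.
    by rewrite /normal subsetIl normsI ?normG // (subset_trans sME) // ker_norm.
  have /simpleP[_ maxM] := simM.
  have [k1|kM] := maxM _ (quotient_normal [group of 'Phi(M)] nskM).
    apply/eqP; rewrite eqEsubset sPk andbT -quotient_sub1 ?k1 //.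
    exact: subset_trans (subsetIl _ _) (normal_norm (Phi_normal M)).
  have sMk : M \subset 'ker_M h.
    by rewrite -(quotientSGK (normal_norm (Phi_normal M)) sPk) -kM.
  have sNP : N \subset 'Phi(N).
    rewrite sub_morphim_pre // (subset_trans sMk) // subIset //.
    by rewrite /= ker_comp ker_coset subxx orbT.
  have := Phi_proper (G := N) ntfM.
  by rewrite properE sNP andbF.
have := first_isog_loc h sME; rewrite ker_h /=.
by rewrite morphim_comp.
Qed.

Lemma head_radical_F1 : F1 (head_radical s).
Proof.
move=> aT rT G f; rewrite sub_morphim_pre; last first.
  apply: head_radical_subP => [|M snM _ _]; [exact: Fstar_sub | exact: subnormal_sub].
apply: (@head_radical_subP _ G (f @*^-1 head_radical s (f @* G))%G) => [|M snM simM sM] /=.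
  rewrite -sub_morphim_pre ?Fstar_sub //.
  exact: subset_trans (Fstar_F1 f) (Fstar_le_head_radical _).
have sMG := subnormal_sub snM; rewrite -sub_morphim_pre //.
have [-> | ntfM] := eqVneq (f @* M) 1; first exact: sub1G.
have isoM := morphim_simple_head sMG simM ntfM.
apply: (@sub_head_radical _ (f @* G)%G (f @* M)%G).
- exact: morphim_subnormal.
- by rewrite -(isog_simple isoM).
by rewrite -(card_isog isoM).
Qed.

Lemma simple_head_sub_Ftilde (gT : finGroupType) (G M : {group gT}) :
  M <|<| G -> simple (M / 'Phi(M)) -> M \subset Ftilde gT G.
Proof.
move=> snM simM; apply: subset_trans (F2_subnormal Ftilde_F2 snM).
rewrite -sub_quotient_pre ?normal_norm ?Phi_normal //.
by apply: (@minnormal_socle _ (M / 'Phi(M))%G (M / 'Phi(M))%G).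
Qed.

Lemma head_radical_Ffunctorial : Ffunctorial (head_radical s).
Proof.
apply/FfunctorialP; split.
- exact: head_radical_F1.
- move=> gT G N nsNG; apply: head_radical_subP => [|M snM simM sM].
    exact: subset_trans (Fstar_F2 nsNG) (Fstar_le_head_radical _).
  exact: sub_head_radical (subnormal_trans snM (normal_subnormal nsNG)) simM sM.
- by move=> gT G; apply: Fstar_le_head_radical.
move=> gT G; apply: head_radical_subP => [|M snM simM _].
  exact: Fstar_le_Ftilde.
exact: simple_head_sub_Ftilde.
Qed.

(** If the order of the head is not in [s], each generator [M] lies in a proper normal subgroup of
    [K], hence in ['Phi(K)]; the radical is then [Fstar gT K], a proper subgroup. *)
Lemma head_radical_full (gT : finGroupType) (K : {group gT}) :
    simple (K / 'Phi(K)) -> ~~ quasinilpotent gT K ->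
  (K \subset head_radical s K) = s #|K / 'Phi(K)|.
Proof.
move=> simK nqK; apply/idP/idP => [sKr|]; last first.
  by apply: sub_head_radical; rewrite ?subnormal_refl.
apply: contraNT nqK => nsK.
suffices eqF : Fstar gT K = K by rewrite -eqF Fstar_quasinilpotent.
apply/group_inj/eqP; rewrite eqEsubset Fstar_sub; apply: subset_trans sKr _.
apply: head_radical_subP => // M snM simM sM.
apply: subset_trans (Phi_sub_Fstar K).
have [eqMK | [N [/subnormal_sub sMN nsNK ltNK]]] := subnormalEr snM.
  by rewrite -eqMK sM in nsK.
apply: subset_trans sMN _.
have nPN := subset_trans (normal_sub nsNK) (normal_norm (Phi_normal K)).
have /simpleP[_ maxK] := simK.
have [N1|NK] := maxK _ (quotient_normal [group of 'Phi(K)] nsNK).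
  by rewrite -quotient_sub1 //= N1.
have : 'Phi(K) <*> N = K.
  by rewrite -quotientYK //= NK quotientGK ?Phi_normal.
by move/Phi_nongen => defN; rewrite -defN genGid properxx in ltNK.
Qed.

End HeadRadical.

(** * Cantor-Bernstein and the coding of functorials by sets of natural numbers *)

Lemma cantor_bernstein_image (A : Type) (B : A -> Prop) (f : A -> A) :
    injective f -> (forall a, B (f a)) ->
  exists h : A -> A, [/\ injective h, forall a, B (h a) & forall b, B b -> exists a, h a = b].
Proof.
(* [C] is the forward orbit under [f] of the complement of [B]; the bijection is [f] on [C] and the
   identity elsewhere. *)
move=> injf Bf; pose C a := exists n x, ~ B x /\ a = iter n f x.
have Cf a : C a -> C (f a) by case=> n [x [nBx ->]]; exists n.+1, x.
have CVf a : C (f a) -> C a.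
  case=> -[|n] [x [nBx /= fa]]; first by case: nBx; rewrite -fa; apply: Bf.
  by exists n, x; split=> //; apply: injf.
exists (fun a => if pb (C a) then f a else a); split.
- move=> a b; case: (pbP (C a)) => Ca; case: (pbP (C b)) => Cb // eqab.
  + exact: injf.
  + by case: Cb; rewrite -eqab; apply: Cf.
  by case: Ca; rewrite eqab; apply: Cf.
- move=> a; case: pbP => // nCa; case: (pbP (B a)) => // nBa.
  by case: nCa; exists 0, a.
move=> b Bb; case: (pbP (C b)) => [[[|n] [x [nBx def_b]]] | nCb].
- by rewrite def_b in Bb.
- exists (iter n f x); case: pbP => [_|[]]; first by [].
  by exists n, x.
by exists b; case: pbP.
Qed.

(** Permutation groups on some ['I_n] form a countable set and represent all finite groups up to
    isomorphism, so membership in [g A] for these [A] determines a functorial. *)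
Definition perm_code (g : fmap) (k : nat) : bool :=
  match (unpickle k : option {n : nat & ({group {perm 'I_n}} * {perm 'I_n})%type}) with
  | Some (existT n (A, x)) => x \in g {perm 'I_n} A
  | None => false
  end.

Section Cayley.
Variables (gT : finGroupType) (G : {group gT}).

Fact cayley_inj (x : gT) : injective (fun i : 'I_#|gT| => enum_rank (enum_val i * x)).
Proof. by move=> i j /enum_rank_inj/mulIg/enum_val_inj. Qed.

Definition cayley (x : gT) : {perm 'I_#|gT|} := perm (@cayley_inj x).

Fact cayleyM : {in G &, {morph cayley : x y / x * y}}.
Proof.
by move=> x y _ _; apply/permP=> i; rewrite permM !permE enum_rankK mulgA.
Qed.
Canonical cayley_morphism := Morphism cayleyM.

Lemma injm_cayley : 'injm cayley_morphism.
Proof.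
apply/injmP=> x y _ _ /permP/(_ (enum_rank 1)).
by rewrite !permE enum_rankK !mul1g => /enum_rank_inj.
Qed.

End Cayley.

Lemma perm_code_inj (g d : fmap) :
  functorial g -> functorial d -> perm_code g = perm_code d -> feq g d.
Proof.
move=> [chg isog] [chd isod] eqgd gT G; pose f := cayley_morphism G.
have injf : 'injm f := injm_cayley G.
apply: (injm_morphim_inj injf); rewrite ?char_sub //.
rewrite isog // isod //; apply/setP=> x.
pose T n := ({group {perm 'I_n}} * {perm 'I_n})%type.
have := congr1 (@^~ (pickle (existT T #|gT| ((f @* G)%G, x)))) eqgd.
by rewrite /perm_code pickleK.
Qed.

Lemma perm_code_feq (g d : fmap) : feq g d -> perm_code g = perm_code d.
Proof.
move=> eqgd; apply: FunctionalExtensionality.functional_extensionality => k.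
by rewrite /perm_code; case: unpickle => [[n [A x]]|] //; rewrite (group_inj (eqgd _ A)).
Qed.

(** * Alternating groups of prime degree and the continuum of F-functorials *)

Fixpoint prime_seq (n : nat) : nat :=
  if n is m.+1 then s2val (prime_above (prime_seq m)) else s2val (prime_above 4).

Lemma prime_seq_prime n : prime (prime_seq n).
Proof. by case: n => [|n] /=; case: prime_above. Qed.

Lemma prime_seqS n : prime_seq n < prime_seq n.+1.
Proof. by rewrite /=; case: prime_above. Qed.

Lemma prime_seq_gt4 n : 4 < prime_seq n.
Proof.
elim: n => [|n IHn]; first by rewrite /=; case: prime_above.
exact: ltn_trans IHn (prime_seqS n).
Qed.

Definition alt_order n := #|'Alt_('F_(prime_seq n))|.

Lemma alt_order_inj : injective alt_order.
Proof.
apply: incn_inj; apply: leq_mono; apply: homo_ltn => [y x z|n]; first exact: ltn_trans.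
(* Twice the order is a factorial, which is strictly increasing in the degree. *)
have dbl_alt m : (2 * alt_order m)%N = (prime_seq m)`!.
  have p_pr := prime_seq_prime m.
  by rewrite card_Alt card_Fp // prime_gt1.
rewrite -(ltn_pmul2l (isT : 0 < 2)) !dbl_alt ltn_fact ?prime_seqS //.
exact/prime_gt0/prime_seq_prime.
Qed.

Definition alt_radical (s : nat -> bool) : fmap :=
  head_radical (fun k => pb (exists2 n, k = alt_order n & s n)).

Lemma alt_radical_inj (s t : nat -> bool) :
  feq (alt_radical s) (alt_radical t) -> s = t.
Proof.
move=> eq_st; apply: FunctionalExtensionality.functional_extensionality => n.
have [K [simK cardK nqK]] := flow_ext_exists (prime_seq_prime n) (prime_seq_gt4 n).
have radK u : (K \subset alt_radical u K) = u n.
  rewrite head_radical_full // cardK; apply/pbP/idP => [[m /alt_order_inj <-] // | un].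
  by exists n.
by rewrite -(radK s) -(radK t) eq_st.
Qed.

Lemma Ffunctorial_continuum :
  exists Phi : (nat -> bool) -> fmap,
    (forall s, Ffunctorial (Phi s)) /\
    (forall s t, feq (Phi s) (Phi t) -> s = t) /\
    (forall g, Ffunctorial g -> exists s, feq (Phi s) g).
Proof.
(* [B] is the set of codes of F-functorials. As [alt_radical] embeds all of [nat -> bool] into it,
   Cantor-Bernstein gives a bijection onto [B], and choice decodes it. *)
pose B s := exists2 g, Ffunctorial g & perm_code g = s.
have code_inj g d : Ffunctorial g -> Ffunctorial d -> perm_code g = perm_code d -> feq g d.
  by move=> [fg _ _ _ _] [fd _ _ _ _]; apply: perm_code_inj.
have Falt s : Ffunctorial (alt_radical s) by apply: head_radical_Ffunctorial.
have [||h [injh Bh hB]] := @cantor_bernstein_image _ B (fun s => perm_code (alt_radical s)).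
- by move=> s t eq_st; apply/alt_radical_inj/code_inj.
- by move=> s; exists (alt_radical s).
have decode s : {g | Ffunctorial g /\ perm_code g = h s}.
  apply: ClassicalEpsilon.constructive_indefinite_description.
  by have [g Fg gh] := Bh s; exists g.
exists (fun s => sval (decode s)); split=> [s|]; first by case: (decode s) => g [].
split=> [s t | g Fg].
  case: (decode s) => g [Fg gs]; case: (decode t) => d [Fd dt] /= /perm_code_feq eqgd.
  by apply: injh; rewrite -gs -dt.
have [s hs] := hB (perm_code g) (ex_intro2 _ _ g Fg erefl).
exists s; case: (decode s) => d [Fd ds] /=; apply: code_inj => //.
by rewrite ds.
Qed.

Theorem theorem1 :
  (* (a) complete distributive lattice *)
  ((forall (I : Type) (g : I -> fmap), inhabited I ->
      (forall i, Ffunctorial (g i)) ->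
      (exists d : fmap, Ffunctorial d /\
         forall (gT : finGroupType) (G : {group gT}),
           d gT G :=: [set x | pb (forall i, x \in g i gT G)]) /\
      (exists d : fmap, Ffunctorial d /\
         forall (gT : finGroupType) (G : {group gT}),
           d gT G :=: << [set x | pb (exists i, x \in g i gT G)] >>)) /\
   (forall g d e : fmap, Ffunctorial g -> Ffunctorial d -> Ffunctorial e ->
      feq (fmeet g (fjoin d e)) (fjoin (fmeet g d) (fmeet g e)) /\
      feq (fjoin g (fmeet d e)) (fmeet (fjoin g d) (fjoin g e))) /\
   Ffunctorial Fstar /\ Ffunctorial Ftilde /\
   (forall g : fmap, Ffunctorial g -> fle Fstar g /\ fle g Ftilde)) /\
  (* (b) semigroup under lower product, zero F*, largest fidempotent F~^oo *)
  ((forall g d : fmap, Ffunctorial g -> Ffunctorial d -> Ffunctorial (fcomp g d)) /\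
   (forall g d e : fmap, feq (fcomp (fcomp g d) e) (fcomp g (fcomp d e))) /\
   (forall g : fmap, Ffunctorial g ->
      feq (fcomp Fstar g) Fstar /\ feq (fcomp g Fstar) Fstar) /\
   Ffunctorial (finf Ftilde) /\ fidempotent (finf Ftilde) /\
   (forall g : fmap, Ffunctorial g -> fidempotent g -> fle g (finf Ftilde))) /\
  (* (c) upper product with a Frattini functorial *)
  (forall g p : fmap, Ffunctorial g -> Frattini_functorial p ->
      Ffunctorial (fstar p g) /\ feq (fstar p Ftilde) Ftilde) /\
  (* (d) the set of F-functorials (up to pointwise equality) has the
     cardinality of the continuum: a bijection with nat -> bool *)
  (exists Phi : (nat -> bool) -> fmap,
      (forall s, Ffunctorial (Phi s)) /\
      (forall s t, feq (Phi s) (Phi t) -> s = t) /\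
      (forall g, Ffunctorial g -> exists s, feq (Phi s) g)).
Proof.
split; [split; [|split; [|split; [|split]]] |
        split; [split; [|split; [|split; [|split; [|split]]]] | split]].
- move=> I g inhI Fg; split; [exists (fbigmeet g) | exists (fbigjoin g)]; split=> //.
  + exact: fbigmeet_Ffunctorial.
  + by move=> gT G; apply: fbigmeetE.
  exact: fbigjoin_Ffunctorial.
- by move=> g d e Fg Fd Fe; split; [apply: fmeet_joinr | apply: fjoin_meetr].
- exact: Fstar_Ffunctorial.
- exact: Ftilde_Ffunctorial.
- by move=> g /FfunctorialP[].
- exact: fcomp_Ffunctorial.
- by move=> g d e gT G.
- by move=> g Fg; split; [apply: fcomp_Fstarl | apply: fcomp_Fstarr].
- exact: finf_Ffunctorial Ftilde_Ffunctorial.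
- exact: finf_idempotent Ftilde_Ffunctorial.
- move=> g Fg idg; apply: fidempotent_le_finf => //; first exact: Ftilde_Ffunctorial.
  by have [_ _ _] := (FfunctorialP g).1 Fg.
- by move=> g p Fg Fp; split; [apply: fstar_Ffunctorial | apply: fstar_Ftilde].
exact: Ffunctorial_continuum.
Qed.
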